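(* Let $S_{\boldsymbol{\lambda}}$ be the (closed, densely defined) weighted shift, on the directed tree $\mathfrak{T}=(V,E)$ of sequences, with the weights $\boldsymbol{\lambda}$, all as described in the context. For any $t\in(0,1]$ the domain of $\Delta_t(S_{\boldsymbol{\lambda}})$ is $\{0\}$.
   Context: Let $\mathbb{Z}_+=\{0,1,2,\ldots\}$. For a sequence $v:\mathbb{Z}\to\mathbb{Z}_+\cup\{-1\}$ put $m(v)=\inf\{n\in\mathbb{Z}:v_n\neq0\}-2$ and $M(v)=\sup\{n\in\mathbb{Z}:v_n>-1\}$. Let $$V=\{v:\mathbb{Z}\to\mathbb{Z}_+\cup\{-1\}\;:\;m(v)>-\infty,\ M(v)<\infty,\ v_n>-1\text{ for }n\le M(v)\},$$ $$E=\{(u,v)\in V\times V\;:\;M(v)=M(u)+1\text{ and }u_n=v_n\text{ for }n\le M(u)\}.$$ Then $\mathfrak{T}=(V,E)$ is a rootless directed tree in which every vertex has countably infinitely many children. For $u\in V$, $\mathrm{Chi}(u)=\{v\in V:(u,v)\in E\}$, and $\mathrm{par}(v)$ is the unique $u$ with $(u,v)\in E$. Define weights $\boldsymbol{\lambda}=\{\lambda_v\}_{v\in V}$ by $$\lambda_v=\frac{2^{v_{m(v)}+\ldots+v_{M(v)-1}}}{v_{M(v)}+1},\qquad v\in V.$$ $\ell^2(V)$ is the complex Hilbert space of square-summable functions $f:V\to\mathbb{C}$. The weighted shift $S_{\boldsymbol{\lambda}}$ is the operator in $\ell^2(V)$ with domain $$\mathcal{D}(S_{\boldsymbol{\lambda}})=\Big\{f\in\ell^2(V):\sum_{u\in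 V}\Big(\sum_{v\in\mathrm{Chi}(u)}|\lambda_v|^2\Big)|f(u)|^2<\infty\Big\}$$ (with $\infty\cdot0=0$) and $(S_{\boldsymbol{\lambda}}f)(v)=\lambda_vf(\mathrm{par}(v))$ for $v\in V$. This operator is closed and densely defined. For a closed densely defined operator $T$ in a Hilbert space with polar decomposition $T=U|T|$ ($|T|=(T^*T)^{1/2}$, $U$ a partial isometry with kernel $\mathcal{N}(T)$) and $t\in(0,1]$, the $t$-Aluthge transform is $\Delta_t(T)=|T|^tU|T|^{1-t}$ with the natural domain of the composition; $|T|^0=I$ is the identity on the whole space. *)

(* Defs.v *)
From HB Require Import structures.
From mathcomp Require Import all_boot all_order all_algebra sesquilinear.
From mathcomp Require Import complex.
From mathcomp Require Import ring lra.
From mathcomp Require Import all_classical all_reals all_analysis.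

Set Implicit Arguments.
Unset Strict Implicit.
Unset Printing Implicit Defensive.

Import Order.TTheory GRing.Theory Num.Theory Num.Def.
Import numFieldNormedType.Exports.

Local Open Scope classical_set_scope.
Local Open Scope ring_scope.

Section csum.
Context {R : realType} {I : choiceType}.
Implicit Types (a b : I -> R) (z : I -> R[i]).
Local Open Scope ereal_scope.

(* Unordered sum, meaningful for an absolutely summable family *)
Definition rsum a : R :=
  fine (esum [set: I] (EFin \o a)^\+ - esum [set: I] (EFin \o a)^\-).

Definition csum z : R[i] :=
  Complex (rsum (fun i => complex.Re (z i))) (rsum (fun i => complex.Im (z i))).

Definition rsummable a := summable [set: I] (EFin \o a).
Definition csummable z :=
  rsummable (fun i => complex.Re (z i)) /\ rsummable (fun i => complex.Im (z i)).

Lemma rsummableD a b : rsummable a -> rsummable b ->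
  rsummable (fun i => a i + b i)%R.
Proof. exact: summableD. Qed.

Lemma esum_ge0_finE (p : I -> R) : (forall i, 0 <= p i)%R ->
  rsummable p -> \esum_(i in [set: I]) (p i)%:E \is a fin_num.
Proof.
move=> p0; rewrite /rsummable summableE; congr (_ \is a fin_num).
by apply: eq_esum => i _ /=; rewrite ger0_norm.
Qed.

Lemma rsumB (p q : I -> R) : (forall i, 0 <= p i)%R -> (forall i, 0 <= q i)%R ->
  rsummable p -> rsummable q ->
  rsum (fun i => p i - q i)%R =
  (fine (\esum_(i in [set: I]) (p i)%:E) - fine (\esum_(i in [set: I]) (q i)%:E))%R.
Proof.
move=> p0 q0 sp sq; rewrite /rsum.
have -> : EFin \o (fun i => p i - q i)%R = (EFin \o p) \- (EFin \o q) by [].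
rewrite esumB//; do ?[by move=> i _; rewrite lee_fin].
by rewrite fineB// esum_ge0_finE.
Qed.

Lemma le_rsummable a b : (forall i, `|a i| <= `|b i|)%R ->
  rsummable b -> rsummable a.
Proof.
by move=> ab; apply: le_lt_trans; apply: le_esum => i _ /=; rewrite lee_fin.
Qed.

Lemma esumZ_le (c : R) (p : I -> R) : (0 <= c)%R -> (forall i, 0 <= p i)%R ->
  \esum_(i in [set: I]) (c * p i)%:E <= c%:E * \esum_(i in [set: I]) (p i)%:E.
Proof.
move=> c0 p0; apply: ub_ereal_sup => _ [A [Afin _] <-].
under eq_fsbigr do rewrite EFinM.
rewrite -ge0_mule_fsumr; last by move=> i; rewrite lee_fin.
rewrite lee_wpmul2l ?lee_fin//; apply: ereal_sup_ubound; by exists A.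
Qed.

Lemma esumZ (c : R) (p : I -> R) : (0 <= c)%R -> (forall i, 0 <= p i)%R ->
  \esum_(i in [set: I]) (c * p i)%:E = c%:E * \esum_(i in [set: I]) (p i)%:E.
Proof.
move=> c0 p0; apply/eqP; rewrite eq_le esumZ_le//=.
have [->|cn0] := eqVneq c 0%R.
  by rewrite mul0e esum_ge0// => i _; rewrite mul0r.
have cp : (0 < c)%R by rewrite lt_neqAle eq_sym cn0.
have := @esumZ_le c^-1 (fun i => c * p i)%R.
rewrite invr_ge0 => /(_ c0 (fun i => mulr_ge0 c0 (p0 i))).
under eq_esum do rewrite mulKf//.
by rewrite lee_pdivlMl.
Qed.

Lemma rsummableZ c a : rsummable a -> rsummable (fun i => c * a i)%R.
Proof.
rewrite /rsummable /summable => sa.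
have -> : \esum_(i in [set: I]) `|(EFin \o (fun i => c * a i)%R) i| =
  \esum_(i in [set: I]) (`|c| * `|a i|)%:E.
  by apply: eq_esum => i _ /=; rewrite normrM.
by rewrite esumZ// lte_mul_pinfty.
Qed.

Let pos a i := Num.max (a i) 0%R.
Let neg a i := Num.max (- a i)%R 0%R.

Let posneg a i : a i = (pos a i - neg a i)%R.
Proof.
rewrite /pos /neg; case: (leP (a i) 0%R) => h.
  by rewrite max_l ?oppr_ge0// sub0r opprK.
by rewrite max_r ?subr0// oppr_le0 ltW.
Qed.
Let pos0 a i : (0 <= pos a i)%R. Proof. by rewrite le_max lexx orbT. Qed.
Let neg0 a i : (0 <= neg a i)%R. Proof. by rewrite le_max lexx orbT. Qed.
Let spos a : rsummable a -> rsummable (pos a).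
Proof.
apply: le_rsummable => i; rewrite ger0_norm// ge_max normr_ge0 andbT.
exact: ler_norm.
Qed.
Let sneg a : rsummable a -> rsummable (neg a).
Proof.
apply: le_rsummable => i; rewrite ger0_norm// ge_max normr_ge0 andbT.
by rewrite -normrN ler_norm.
Qed.

Lemma rsumD a b : rsummable a -> rsummable b ->
  rsum (fun i => a i + b i)%R = (rsum a + rsum b)%R.
Proof.
move=> sa sb.
have -> : (fun i => a i + b i)%R =
  (fun i => (pos a i + pos b i) - (neg a i + neg b i))%R.
  apply/funext => i; rewrite {1}(posneg a) {1}(posneg b) opprD.
  by rewrite addrACA.
rewrite [X in _ = (rsum X + _)%R](_ : _ = (fun i => pos a i - neg a i)%R); last first.
  by apply/funext => i; exact: posneg.
rewrite [X in _ = (_ + rsum X)%R](_ : _ = (fun i => pos b i - neg b i)%R); last first.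
  by apply/funext => i; exact: posneg.
have [spa spb sna snb] := And4 (spos sa) (spos sb) (sneg sa) (sneg sb).
rewrite !rsumB//; do ?[exact: rsummableD | by move=> i; rewrite addr_ge0].
under eq_esum do rewrite EFinD.
rewrite esumD; do ?[by move=> i _; rewrite lee_fin].
rewrite fineD ?esum_ge0_finE//.
under [X in (_ - fine X)%R]eq_esum do rewrite EFinD.
rewrite esumD; do ?[by move=> i _; rewrite lee_fin].
by rewrite fineD ?esum_ge0_finE// opprD addrACA.
Qed.

Lemma rsumN a : rsummable a -> rsum (fun i => - a i)%R = (- rsum a)%R.
Proof.
move=> sa; have [spa sna] := conj (spos sa) (sneg sa).
rewrite [X in rsum X](_ : _ = (fun i => neg a i - pos a i)%R); last first.
  by apply/funext => i; rewrite {1}(posneg a i) opprB.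
rewrite [X in _ = (- rsum X)%R](_ : _ = (fun i => pos a i - neg a i)%R); last first.
  by apply/funext => i; exact: posneg.
by rewrite !rsumB// opprB.
Qed.

Lemma rsumZ c a : rsummable a -> rsum (fun i => c * a i)%R = (c * rsum a)%R.
Proof.
move=> sa; wlog c0 : c / (0 <= c)%R => [hw|].
  have [/hw//|/ltW c0] := leP 0%R c.
  rewrite -[c]opprK [RHS]mulNr -hw ?oppr_ge0// -rsumN; last exact: rsummableZ.
  by congr rsum; apply/funext => i; rewrite !mulNr.
have [spa sna] := conj (spos sa) (sneg sa).
rewrite [X in _ = (_ * rsum X)%R](_ : _ = (fun i => pos a i - neg a i)%R); last first.
  by apply/funext => i; exact: posneg.
rewrite [X in rsum X](_ : _ = (fun i => c * pos a i - c * neg a i)%R); last first.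
  by apply/funext => i; rewrite {1}(posneg a i) mulrBr.
rewrite !rsumB//; do ?[exact: rsummableZ | by move=> i; rewrite mulr_ge0].
by rewrite !esumZ// !fineM ?esum_ge0_finE// mulrBr.
Qed.

Lemma rsum_ge0 a : (forall i, 0 <= a i)%R -> rsummable a ->
  rsum a = fine (\esum_(i in [set: I]) (a i)%:E).
Proof.
move=> a0 sa; have s0 : rsummable (fun=> 0%R).
  by apply: le_rsummable sa => i; rewrite normr0.
have {1}-> : a = (fun i => a i - 0)%R by apply/funext => i; rewrite subr0.
rewrite rsumB//; have -> : \esum_(i in [set: I]) (0 : R)%:E = 0 by exact: esum1.
by rewrite subr0.
Qed.

End csum.

Section l2.
Context {R : realType} (I : choiceType).
Local Notation C := R[i].
Local Notation normc := ComplexField.Normc.normc.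

Lemma sqr_normcE (z : C) : normc z ^+ 2 = complex.Re z ^+ 2 + complex.Im z ^+ 2.
Proof. by case: z => x y /=; rewrite sqr_sqrtr// addr_ge0// sqr_ge0. Qed.

Definition l2_pred : {pred I -> C} :=
  fun f => `[< (\esum_(i in [set: I]) (normc (f i) ^+ 2)%:E < +oo)%E >].

Lemma l2_predP f : f \in l2_pred <-> rsummable (fun i => normc (f i) ^+ 2).
Proof.
rewrite unfold_in /l2_pred /rsummable /summable.
have -> : \esum_(i in [set: I]) (`|(EFin \o (fun i0 => (normc (f i0) ^+ 2)%R)) i|)%E =
   \esum_(i in [set: I]) (normc (f i) ^+ 2)%:E.
  by apply: eq_esum => i _ /=; rewrite ger0_norm// sqr_ge0.
by split=> /asboolP.
Qed.

Lemma l2_submod_closed : submod_closed l2_pred.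
Proof.
split=> [|c f g /l2_predP sf /l2_predP sg].
  apply/l2_predP; rewrite /rsummable /summable esum1 ?ltry// => i _ /=.
  by rewrite [0 ^+ 2]expr0n addr0 sqrtr0 expr0n normr0.
apply/l2_predP.
apply: (@le_rsummable _ _ _
   (fun i => (2 * normc c ^+ 2) * normc (f i) ^+ 2 + 2 * normc (g i) ^+ 2)); last first.
  by apply: rsummableD; exact: rsummableZ.
move=> i; rewrite ger0_norm ?sqr_ge0//.
rewrite ger0_norm; last first.
  apply: addr_ge0; last by apply: mulr_ge0; [exact: ler0n|exact: sqr_ge0].
  apply: mulr_ge0; last exact: sqr_ge0.
  by apply: mulr_ge0; [exact: ler0n|exact: sqr_ge0].
have -> : (c *: f + g) i = c * f i + g i by [].
rewrite -mulrA -exprMn -ComplexField.Normc.normcM !sqr_normcE.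
have -> u v : complex.Re (u + v) = complex.Re u + complex.Re v :> R by case: u v => ? ? [? ?].
have -> u v : complex.Im (u + v) = complex.Im u + complex.Im v :> R by case: u v => ? ? [? ?].
set a := complex.Re (c * _); set b := complex.Im (c * _).
set a' := complex.Re (g i); set b' := complex.Im (g i).
have := addr_ge0 (sqr_ge0 (a - a')) (sqr_ge0 (b - b')); nra.
Qed.
HB.instance Definition _ := GRing.isSubmodClosed.Build C (I -> C) l2_pred
  l2_submod_closed.

Record l2 : Type := L2 { l2_fun :> I -> C; l2_funP : l2_fun \in l2_pred }.
HB.instance Definition _ := [isSub for l2_fun].
HB.instance Definition _ := [Choice of l2 by <:].
HB.instance Definition _ := [SubChoice_isSubLmodule of l2 by <:].

(* The inner product of l^2(I), linear in the first variable *)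
Definition l2_dot (f g : l2) : C := csum (fun i => f i * conjC (g i)).


Local Notation Re := complex.Re.
Local Notation Im := complex.Im.

Lemma csumD (z w : I -> C) : csummable z -> csummable w ->
  csum (fun i => z i + w i) = csum z + csum w.
Proof.
move=> [zr zi] [wr wi]; rewrite /csum.
rewrite [RHS](_ : _ = Complex (rsum (fun i => Re (z i)) + rsum (fun i => Re (w i)))
   (rsum (fun i => Im (z i)) + rsum (fun i => Im (w i))))//.
rewrite -!rsumD//; congr Complex; congr rsum; apply/funext => i.
  by case: (z i) (w i) => ? ? [].
by case: (z i) (w i) => ? ? [].
Qed.

Lemma csumZ (c : C) (z : I -> C) : csummable z ->
  csum (fun i => c * z i) = c * csum z.
Proof.
case: c => a b [zr zi]; rewrite /csum.
rewrite [RHS](_ : _ = Complex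
   (a * rsum (fun i => Re (z i)) + - b * rsum (fun i => Im (z i)))
   (a * rsum (fun i => Im (z i)) + b * rsum (fun i => Re (z i)))); last first.
  by rewrite mulNr.
rewrite -!rsumZ// -!rsumD//; do ?exact: rsummableZ.
congr Complex; congr rsum; apply/funext => i; case: (z i) => x y //=.
by rewrite mulNr.
Qed.

Lemma csum_conj (z : I -> C) : csummable z ->
  csum (fun i => conjC (z i)) = conjC (csum z).
Proof.
move=> [zr zi]; rewrite /csum.
rewrite [RHS](_ : _ = Complex (rsum (fun i => Re (z i)))
   (- rsum (fun i => Im (z i))))//.
rewrite -rsumN//; congr Complex; congr rsum; apply/funext => i.
  by case: (z i).
by case: (z i).
Qed.

Lemma csummable_dot (f g : l2) : csummable (fun i => f i * conjC (g i)).
Proof.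
have sf := (l2_predP f).1 (l2_funP f).
have sg := (l2_predP g).1 (l2_funP g).
have s := rsummableD sf sg.
have aux (z : C) i : z = f i * conjC (g i) ->
    Re z ^+ 2 + Im z ^+ 2 <= (normc (f i) ^+ 2 + normc (g i) ^+ 2) ^+ 2.
  move=> ->; rewrite -sqr_normcE ComplexField.Normc.normcM exprMn.
  have -> : normc (conjC (g i)) = normc (g i).
    by case: (g i) => x y /=; rewrite sqrrN.
  have := sqr_ge0 (normc (f i)); have := sqr_ge0 (normc (g i)); nra.
have bnd i (x y : R) : x ^+ 2 + y ^+ 2 <= (normc (f i) ^+ 2 + normc (g i) ^+ 2) ^+ 2 ->
    `|x| <= `|normc (f i) ^+ 2 + normc (g i) ^+ 2|.
  move=> h; rewrite -ler_sqr ?nnegrE// !real_normK ?num_real//.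
  by apply: le_trans h; rewrite lerDl sqr_ge0.
split; apply: le_rsummable s => i; apply: bnd.
  exact: aux.
by rewrite addrC; exact: aux.
Qed.

Lemma l2_dot_linearl (h : l2) : linear_for *%R (l2_dot^~ h).
Proof.
move=> c f g; rewrite /l2_dot -csumZ; last exact: csummable_dot.
rewrite -csumD; last exact: csummable_dot; last first.
  have := csummable_dot (c *: f) h; congr csummable; apply/funext => i.
  by rewrite mulrA.
by congr csum; apply/funext => i; rewrite mulrA -mulrDl.
Qed.

Lemma l2_dot_hermitian (f g : l2) : l2_dot f g = (-1) ^+ false * conjC (l2_dot g f).
Proof.
rewrite expr0 mul1r /l2_dot -csum_conj; last exact: csummable_dot.
by congr csum; apply/funext => i; rewrite rmorphM/= conjCK mulrC.
Qed.

Lemma l2_dot_linearr (h : l2) : linear_for (conjC \; *%R) (l2_dot h).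
Proof.
move=> c f g; rewrite [LHS]l2_dot_hermitian [l2_dot h f]l2_dot_hermitian.
rewrite [l2_dot h g]l2_dot_hermitian !expr0 !mul1r l2_dot_linearl.
by rewrite rmorphD rmorphM.
Qed.

Lemma l2_dot_gt0 (f : l2) : f != 0 -> 0 < l2_dot f f.
Proof.
move=> f0; have sf := (l2_predP f).1 (l2_funP f).
have -> : l2_dot f f = Complex (rsum (fun i => normc (f i) ^+ 2)) 0.
  rewrite /l2_dot /csum; congr Complex.
    by congr rsum; apply/funext => i; rewrite sqr_normcE; case: (f i) => x y /=; ring.
  rewrite (_ : (fun i => _) = (fun i => 0 * normc (f i) ^+ 2)).
    by rewrite rsumZ// mul0r.
  by apply/funext => i; case: (f i) => x y /=; ring.
rewrite ltcE/= eqxx/= rsum_ge0//.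
  have [i fi0] : exists i, f i != 0.
    apply: contrapT => h; move/eqP: f0; apply; apply: val_inj; apply/funext => i.
    by apply/eqP/negPn/negP => fi; apply: h; exists i.
  apply: (@lt_le_trans _ _ (normc (f i) ^+ 2)).
    rewrite exprn_gt0// lt_def; apply/andP; split.
      by apply: contra fi0 => /eqP/ComplexField.Normc.eq0_normc ->.
    by case: (f i) => x y /=; rewrite sqrtr_ge0.
  rewrite -lee_fin fineK; last first.
    by apply: esum_ge0_finE sf => j; exact: sqr_ge0.
  rewrite (esumID [set i])//; last by move=> ? _; rewrite lee_fin sqr_ge0.
  rewrite setTI esum_set1; last by rewrite lee_fin sqr_ge0.
  rewrite leeDl//; apply: esum_ge0 => ? _; rewrite lee_fin; exact: sqr_ge0.
by move=> ?; exact: sqr_ge0.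
Qed.

HB.instance Definition _ := bilinear_isBilinear.Build C l2 l2 C
  *%R (conjC \; *%R) l2_dot (l2_dot_linearl, l2_dot_linearr).
HB.instance Definition _ := isHermitianSesquilinear.Build C l2 false conjC
  l2_dot l2_dot_hermitian.
HB.instance Definition _ := isDotProduct.Build C l2 l2_dot l2_dot_gt0.

End l2.

(* An operator is identified with its graph, so that equality of operators
   includes equality of domains. *)
Definition operator (R : realType) (H : lmodType R[i]) := set (H * H).

Section operators.
Context {R : realType} {H : lmodType R[i]} (ip : {dot H for conjC}).
Local Notation C := R[i].
Implicit Types (A S T : operator H) (U P : H -> H) (f g h : H).

Definition dom T : set H := [set f | exists g, T (f, g)].

(* Natural domain: {f in dom T | T f in dom S} *)
Definition opcomp S T : operator H :=
  [set p | exists h, T (p.1, h) /\ S (h, p.2)].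

Definition everywhere U : operator H := [set p | p.2 = U p.1].

Definition adjoint T : operator H :=
  [set p | forall f g, T (f, g) -> ip g p.1 = ip f p.2].

Definition orth_projection P :=
  [/\ linear P, forall f, P (P f) = P f & forall f g, ip (P f) g = ip f (P g)].

(* The measure <E(.) f, f> of a projection-valued set function E *)
Definition spec_meas (E : set (measurableTypeR R) -> H -> H) f
    (B : set (measurableTypeR R)) : \bar R :=
  (complex.Re (ip (E B f) f))%:E.

Definition spectral_measure (E : set (measurableTypeR R) -> H -> H) :=
  [/\ forall B, measurable B -> orth_projection (E B),
      E setT = id &
      forall f, semi_sigma_additive (spec_meas E f)].

(* The integral of phi against the complex measure <E(.) f, g>, which is
   (1/4) sum_k i^k <E(.) (f + i^k g), f + i^k g> by polarization *)
Definition spec_form (E : set (measurableTypeR R) -> H -> H) (phi : R -> R)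
    f g : C :=
  4^-1 * \sum_(k < 4) 'i%C ^+ k *
    (fine (\int[spec_meas E (f + 'i%C ^+ k *: g)]_x (phi x)%:E))%:C%C.

Definition spec_dom (E : set (measurableTypeR R) -> H -> H) (phi : R -> R) :
    set H :=
  [set f | (\int[spec_meas E f]_x ((phi x) ^+ 2)%:E < +oo)%E].

(* The operator int phi dE.  Testing against g in the (dense) domain only
   ensures that the four integrals in [spec_form] are finite. *)
Definition spec_int (E : set (measurableTypeR R) -> H -> H) (phi : R -> R) :
    operator H :=
  [set p | spec_dom E phi p.1 /\
     forall g, spec_dom E phi g -> ip p.2 g = spec_form E phi p.1 g].

(* The power A^s (s >= 0) of a positive selfadjoint operator A = int x dE,
   where E is carried by [0, +oo[, is int x^s dE.  Since 0 `^ 0 = 1, A^0 is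
   the identity on the whole space.  The value is the empty graph, which is
   not a linear operator, if A has no such spectral measure. *)
Definition is_oppow A (s : R) (B : operator H) :=
  exists E, [/\ spectral_measure E, E [set x | 0 <= x] = id,
    A = spec_int E id & B = spec_int E (fun x => x `^ s)].

Definition oppow A (s : R) : operator H := xget set0 [set B | is_oppow A s B].

Definition opabs T : operator H := oppow (opcomp (adjoint T) T) (2^-1).

Definition partial_isometry U :=
  [/\ linear U,
      exists M : R, forall f, ip (U f) (U f) <= M%:C%C * ip f f &
      forall f, (forall g, U g = 0 -> ip f g = 0) -> ip (U f) (U f) = ip f f].

Definition is_polar_factor T U :=
  [/\ partial_isometry U,
      forall f, U f = 0 <-> T (f, 0) &
      T = opcomp (everywhere U) (opabs T)].

(* The factor U of T = U |T| is unique, its kernel being that of T. *)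
Definition polar_factor T : H -> H := xget (fun=> 0) [set U | is_polar_factor T U].

Definition aluthge (t : R) T : operator H :=
  opcomp (oppow (opabs T) t)
    (opcomp (everywhere (polar_factor T)) (oppow (opabs T) (1 - t))).

End operators.

(* m(v) and M(v); the sets are bounded and nonempty when v is a vertex *)
Definition seq_m (v : int -> int) : int :=
  infimum (0 : int) [set n : int | v n != 0] - 2.
Definition seq_M (v : int -> int) : int :=
  supremum (0 : int) [set n : int | -1 < v n].

(* With inf set0 = +oo and sup set0 = -oo, the conditions m(v) > -oo and
   M(v) < oo say that the sets are bounded below, resp. above. *)
Definition vertices : set (int -> int) :=
  [set v | [/\ forall n, -1 <= v n,
               has_lbound [set n : int | v n != 0],
               has_ubound [set n : int | -1 < v n] &
               forall n, n <= seq_M v -> -1 < v n]].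

Definition vertex : choiceType := set_type vertices.

Definition edge (u v : vertex) : Prop :=
  seq_M (val v) = seq_M (val u) + 1 /\
  forall n, n <= seq_M (val u) -> val u n = val v n.

Definition children (u : vertex) : set vertex := [set v | edge u v].

(* Every vertex has exactly one parent, so the default is never returned *)
Definition parent (v : vertex) : vertex := xget v [set u | edge u v].

Section weighted_shift.
Context (R : realType).

(* The exponent is the sum of v_n over m(v) <= n < M(v), a nonnegative
   integer. *)
Definition weight (v : vertex) : R :=
  let m := seq_m (val v) in let M := seq_M (val v) in
  (2 : R) ^ (\sum_(k < `|M - m|%N) val v (m + k%:Z)) / (val v M + 1)%:~R.

Definition weighted_shift (lambda : vertex -> R) :
    operator (l2 vertex : lmodType R[i]) :=
  [set p : l2 vertex * l2 vertex |
    (\esum_(u in [set: vertex])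
       ((\esum_(v in children u) (`|lambda v| ^+ 2)%:E) *
        (ComplexField.Normc.normc (p.1 u) ^+ 2)%:E) < +oo)%E /\
    forall v, p.2 v = (lambda v)%:C%C * p.1 (parent v)].

End weighted_shift.

(* Main.v *)
Require Import Defs.
From HB Require Import structures.
From mathcomp Require Import all_boot all_order all_algebra sesquilinear.
From mathcomp Require Import complex.
From mathcomp Require Import ring lra zify.
From mathcomp Require Import all_classical all_reals all_analysis.
From mathcomp Require Import measurable_realfun.

Set Implicit Arguments.
Unset Strict Implicit.
Unset Printing Implicit Defensive.

Import Order.TTheory GRing.Theory Num.Theory Num.Def.
Import numFieldNormedType.Exports.

Local Open Scope classical_set_scope.
Local Open Scope ring_scope.

(** Let w(u) be the norm of S e_u. The weight of the k-th child of u is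
2^a / (k + 1), where a is the sum of the entries of u up to M(u), so that
w(u)^2 = z 4^a with z the sum of the 1 / (k + 1)^2, and w is multiplied by 2^k
when one passes from u to its k-th child. The operator |S| is the
multiplication by w, and U is the isometry (U g)(v) = weight(v) / w(par v) *
g(par v). If f is in the domain of |S|^t U |S|^(1-t), put g = w^(1-t) f; the
value of w^t U g at the k-th child of u is g(u) times a positive constant
times 2^(t k) / (k + 1). This is unbounded in k unless g(u) = 0, whereas a
square-summable family is bounded ([polar_powR_null]). Hence g = 0, and f = 0
because w > 0.

The powers of |S| are chosen among all spectral measures, so both their
existence and their uniqueness have to be established; for multiplication
operators neither requires the spectral theorem.

Existence: E(B) f is f cut off to the points where w lies in B. As w takes
countably many values, <E(.) f, f> is a countable sum of point masses, its
integrals are sums over the points, and the integral of phi with respect to E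
is the multiplication by phi(w) ([restr_spectral], [spec_int_diagonal]).

Uniqueness: let E be any spectral measure whose integral of x is the
multiplication by w. Each e_u is an eigenvector, with eigenvalue a = w(u), say.
For B on one side of a, the eigenvalue equation tested against E(B) e_u says
that the measure of E(B) e_u, which lives on B, has mean a; so E(B) e_u = 0
([spec_eigen_oneside]). Therefore E(B) e_u is e_u or 0 according as w(u) is
in B ([spec_eigen]), and E(B), being selfadjoint, is the cut-off above
([diagonal_spec]). This computes all powers ([oppow_mul_op]).

Finally S = U w with U isometric gives S*S = w^2 ([adjoint_shift]), hence
|S| = w; and since w >= 1, the operator |S| is onto, so that S = U |S|
determines U ([polar_factor_shift]). *)

(** * Real parts and inner products *)

Section complex_parts.
Context {R : realType}.
Implicit Types z w : R[i].
Local Notation Re := complex.Re.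
Local Notation Im := complex.Im.

Lemma ReD z w : Re (z + w) = Re z + Re w. Proof. by case: z w => ? ? []. Qed.
Lemma ImD z w : Im (z + w) = Im z + Im w. Proof. by case: z w => ? ? []. Qed.
Lemma ReN z : Re (- z) = - Re z. Proof. by case: z. Qed.
Lemma ReB z w : Re (z - w) = Re z - Re w. Proof. by rewrite ReD ReN. Qed.
Lemma Re_conj z : Re (conjC z) = Re z. Proof. by case: z. Qed.
Lemma Re_realM (a : R) z : Re (a%:C%C * z) = a * Re z.
Proof. by case: z => x y /=; rewrite mul0r subr0. Qed.

Lemma conj_realM (a : R) z : conjC (a%:C%C * z) = a%:C%C * conjC z.
Proof.
by case: z => x y; apply/eqP; rewrite eq_complex /=; apply/andP; split;
  apply/eqP; ring.
Qed.

End complex_parts.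

Lemma sum_ord4 (V : nmodType) (F : nat -> V) :
  \sum_(k < 4) F k = F 0%N + F 1%N + F 2%N + F 3%N.
Proof. by rewrite !big_ord_recr big_ord0 /= add0r. Qed.

Section inner_product.
Context {R : realType} {H : lmodType R[i]} (ip : {dot H for conjC}).
Implicit Types (f g h : H) (P Q D : H -> H).
Local Notation Re := complex.Re.

Definition sqnorm f : R := Re (ip f f).

Lemma ip_conj f g : ip f g = conjC (ip g f).
Proof. rewrite hermC expr0 mul1r; reflexivity. Qed.

Lemma Re_ipC f g : Re (ip f g) = Re (ip g f).
Proof. by rewrite ip_conj Re_conj. Qed.

Lemma ip_sqnorm f : ip f f = (sqnorm f)%:C%C.
Proof.
have := dnorm_ge0 ip f; rewrite /sqnorm; case: (ip f f) => x y /=.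
by rewrite lecE/= => /andP[/eqP -> _].
Qed.

Lemma sqnorm_ge0 f : 0 <= sqnorm f.
Proof. by have := dnorm_ge0 ip f; rewrite ip_sqnorm lecE/= => /andP[]. Qed.

Lemma sqnorm_eq0 f : sqnorm f = 0 -> f = 0.
Proof. by move=> h; apply/eqP; rewrite -(dnorm_eq0 ip) ip_sqnorm h. Qed.

Lemma sqnormD f g : sqnorm (f + g) = sqnorm f + sqnorm g + 2 * Re (ip f g).
Proof.
by rewrite /sqnorm linearDl/= !linearDr/= !ReD (Re_ipC g f); ring.
Qed.

Lemma Re_ipZ (a : R) f g : Re (ip (a%:C%C *: f) g) = a * Re (ip f g).
Proof. by rewrite linearZl_LR/= Re_realM. Qed.

Lemma Re_ipZr (a : R) f g : Re (ip f (a%:C%C *: g)) = a * Re (ip f g).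
Proof. by rewrite Re_ipC Re_ipZ Re_ipC. Qed.

Lemma sqnormZ (a : R) f : sqnorm (a%:C%C *: f) = a ^+ 2 * sqnorm f.
Proof. by rewrite /sqnorm Re_ipZ Re_ipZr mulrA. Qed.

Lemma sqnorm0 : sqnorm 0 = 0.
Proof. by rewrite /sqnorm linear0l. Qed.


Section projection.
Variable P : H -> H.
Hypothesis pP : orth_projection ip P.

Let Plin : linear P. Proof. by case: pP. Qed.

Lemma projD f g : P (f + g) = P f + P g.
Proof. by have := Plin 1 f g; rewrite !scale1r. Qed.
Lemma proj0 : P 0 = 0.
Proof. by have := Plin (-1) 0 0; rewrite !scaleN1r !addNr. Qed.
Lemma projZ a f : P (a *: f) = a *: P f.
Proof. by have := Plin a f 0; rewrite proj0 !addr0. Qed.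
Lemma projK f : P (P f) = P f. Proof. by case: pP. Qed.
Lemma proj_adj f g : ip (P f) g = ip f (P g). Proof. by case: pP. Qed.

Lemma Re_ip_proj f : Re (ip (P f) f) = sqnorm (P f).
Proof. by rewrite /sqnorm [in RHS]proj_adj projK -proj_adj. Qed.

Lemma sqnorm_proj f : sqnorm f = sqnorm (P f) + sqnorm (f - P f).
Proof.
have o : ip (P f) (f - P f) = 0 by rewrite linearBr/= -[ip (P f) (P f)]proj_adj projK subrr.
by rewrite -{1}(subrKC (P f) f) [LHS]sqnormD o mulr0 addr0.
Qed.

Lemma sqnorm_proj_le f : sqnorm (P f) <= sqnorm f.
Proof. by rewrite (sqnorm_proj f) lerDl sqnorm_ge0. Qed.


End projection.
End inner_product.

(** * Spectral measures *)

Import HBNNSimple.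

(** The value of the integral depends on the measurable sets only, which
matters because a spectral measure is unconstrained on the other ones. *)
Lemma eq_setfun_integral d (T : measurableType d) (R : realType)
    (m1 m2 : set T -> \bar R) (f : T -> \bar R) :
  (forall A, measurable A -> m1 A = m2 A) ->
  (\int[m1]_x f x = \int[m2]_x f x)%E.
Proof.
move=> m12; rewrite /integral.
by congr (ereal_sup _ - ereal_sup _)%E; apply: eq_imagel => h _;
  apply: eq_fsbigr => x _; rewrite m12.
Qed.

Section spectral_measure.
Context {R : realType} {H : lmodType R[i]} (ip : {dot H for conjC}).
Local Notation Re := complex.Re.
Local Notation T := (measurableTypeR R).
Variable E : set T -> H -> H.
Hypothesis sE : spectral_measure ip E.
Implicit Types (f g h : H) (B C : set T).
Local Notation N := (sqnorm ip).

Let pE B : measurable B -> orth_projection ip (E B).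
Proof. by case: sE => h _ _; exact: h. Qed.

Lemma spec_meas_sqnorm f B : measurable B -> spec_meas ip E f B = (N (E B f))%:E.
Proof. by move=> mB; rewrite /spec_meas (Re_ip_proj (pE mB)). Qed.

Lemma spec_set0 f : E set0 f = 0.
Proof.
apply: (@sqnorm_eq0 _ _ ip).
case: sE => _ _ /(_ f (fun=> set0)).
rewrite bigcup0//.
(* a series with constant terms converges only if they vanish *)
have c n : (\sum_(0 <= i < n) spec_meas ip E f set0 = (N (E set0 f) *+ n)%:E)%E.
  rewrite (eq_bigr (fun=> (N (E set0 f))%:E)); last first.
    by move=> i _; rewrite spec_meas_sqnorm.
  by rewrite sumEFin big_const_nat iter_addr_0 subn0.
move=> /(_ (fun=> measurable0) (@trivIset_set0 _ _ _) measurable0).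
under eq_fun do rewrite c.
rewrite spec_meas_sqnorm// => /fine_cvgP[_] /= s0.
have s1 : (fun n => N (E set0 f) *+ n.+1) @ \oo --> N (E set0 f).
  by rewrite (cvg_shiftS (fun n => N (E set0 f) *+ n)).
have s2 : (fun n => N (E set0 f) *+ n.+1) @ \oo --> N (E set0 f) + N (E set0 f).
  under eq_fun do rewrite mulrS.
  by apply: cvgD => //; exact: cvg_cst.
have e : N (E set0 f) = N (E set0 f) + N (E set0 f) by exact: cvg_unique s1 s2.
by move/eqP: e; rewrite -subr_eq0 opprD addNKr oppr_eq0 => /eqP.
Qed.

(** The measure <E(.) f, f>, cut off outside the measurable sets to make it
a genuine nonnegative set function. *)
Definition specm (_ : spectral_measure ip E) f B : \bar R :=
  if pselect (measurable B) then (N (E B f))%:E else 0%E.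

Lemma specmE f B : measurable B -> specm sE f B = (N (E B f))%:E.
Proof. by rewrite /specm; case: pselect. Qed.

Let specm0 f : specm sE f set0 = 0%E.
Proof. by rewrite specmE// spec_set0 sqnorm0. Qed.

Let specm_ge0 f B : (0 <= specm sE f B)%E.
Proof. by rewrite /specm; case: pselect => //= _; rewrite lee_fin sqnorm_ge0. Qed.

Let specm_sigma_additive f : semi_sigma_additive (specm sE f).
Proof.
move=> F mF tF mUF; rewrite specmE// -spec_meas_sqnorm//.
have [_ _ /(_ f F mF tF mUF)] := sE.
by under eq_fun do under eq_bigr do rewrite spec_meas_sqnorm// -specmE//.
Qed.

HB.instance Definition _ f := isMeasure.Build _ _ _ (specm sE f)
  (specm0 f) (specm_ge0 f) (@specm_sigma_additive f).

Lemma integral_spec_meas f (phi : T -> \bar R) :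
  (\int[spec_meas ip E f]_x phi x = \int[specm sE f]_x phi x)%E.
Proof.
by apply: eq_setfun_integral => A mA; rewrite specmE// spec_meas_sqnorm.
Qed.

Lemma sqnorm_specU f B C : measurable B -> measurable C -> B `&` C = set0 ->
  N (E (B `|` C) f) = N (E B f) + N (E C f).
Proof.
move=> mB mC BC; have := @measureU _ _ _ (specm sE f) _ _ mB mC BC.
by rewrite /= !specmE//; [case|exact: measurableU].
Qed.

(** A selfadjoint operator is zero as soon as its quadratic form is, and the
quadratic forms add up. *)
Lemma specU f B C : measurable B -> measurable C -> B `&` C = set0 ->
  E (B `|` C) f = E B f + E C f.
Proof.
move=> mB mC BC; have mBC := measurableU _ _ mB mC.
have [pB pC pBC] := And3 (pE mB) (pE mC) (pE mBC).
pose D h := E (B `|` C) h - (E B h + E C h).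
have DD h k : D (h + k) = D h + D k.
  rewrite /D (projD pB) (projD pC) (projD pBC).
  by rewrite [X in _ - X]addrACA opprD addrACA.
have Da h k : ip (D h) k = ip h (D k).
  by rewrite /D !linearBl/= !linearBr/= !linearDl/= !linearDr/= !(proj_adj _).
have D0 h : Re (ip (D h) h) = 0.
  rewrite /D linearBl/= linearDl/= ReB ReD !Re_ip_proj//.
  by rewrite sqnorm_specU// subrr.
suff : D f = 0 by exact: subr0_eq.
clearbody D; apply: (@sqnorm_eq0 _ _ ip).
have := D0 (f + D f); rewrite DD linearDl/= !linearDr/= !ReD D0 D0.
rewrite (Da (D f) f) Re_ipC -/(sqnorm ip (D f)) => e; lra.
Qed.

(** A vector f in the range of E(C) satisfies |E(B) f|^2 + |f|^2 =
|E(B u C) f|^2 <= |f|^2. *)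
Lemma spec_orth f B C : measurable B -> measurable C -> B `&` C = set0 ->
  E B (E C f) = 0.
Proof.
move=> mB mC BC; apply: (@sqnorm_eq0 _ _ ip).
have := sqnorm_specU (E C f) mB mC BC; rewrite (projK (pE mC)).
have := sqnorm_proj_le (pE (measurableU _ _ mB mC)) (E C f).
have := sqnorm_ge0 ip (E B (E C f)); lra.
Qed.

Lemma spec_compl f B : measurable B -> E B f + E (~` B) f = f.
Proof.
move=> mB; rewrite -specU ?setICr ?setUv//; last exact: measurableC.
by case: sE => _ ->.
Qed.

Lemma spec_eq0_sub f B C : measurable B -> measurable C -> C `<=` B ->
  E B f = 0 -> E C f = 0.
Proof.
move=> mB mC CB e; apply: (@sqnorm_eq0 _ _ ip).
have := sqnorm_specU f mC (measurableD mB mC) (setDIK _ _).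
rewrite setDUK// e sqnorm0.
have := sqnorm_ge0 ip (E C f).
have := sqnorm_ge0 ip (E (B `\` C) f); lra.
Qed.


(** Cut C along B: one piece kills the range of E(~B), the other is killed by
E(B). *)
Lemma spec_sandwich f B C : measurable B -> measurable C ->
  E B (E C (E (~` B) f)) = 0.
Proof.
move=> mB mC; have mB' := measurableC mB.
rewrite -[in E C _](setUIDK C B) (specU _ (measurableI _ _ mC mB)) //; last 2 first.
- exact: measurableD.
- by rewrite setDE setIACA setICr setI0.
rewrite spec_orth ?add0r//; last 2 first.
- exact: measurableI.
- by rewrite -setIA setICr setI0.
by rewrite spec_orth// ?setDIK//; exact: measurableD.
Qed.

(** For p = E(B) f and q = E(~B) f the measures of p and q add up, because
E commutes with E(B). *)
Lemma specm_split f B C (z : R) : measurable B -> measurable C ->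
  specm sE (E (~` B) f + z%:C%C *: E B f) C =
  (specm sE (E (~` B) f) C + (z ^+ 2)%:E * specm sE (E B f) C)%E.
Proof.
move=> mB mC; have [pC pB] := conj (pE mC) (pE mB).
rewrite !specmE// (projD pC) (projZ pC) sqnormD sqnormZ.
rewrite Re_ipZr -(proj_adj pC) (projK pC) -(proj_adj pB) spec_sandwich//.
by rewrite linear0l mulr0 mulr0 addr0 -EFinM -EFinD.
Qed.

Lemma integral_specm_split f B (z : R) (phi : T -> \bar R) :
  measurable B -> measurable_fun setT phi -> (forall x, 0 <= phi x)%E ->
  (\int[specm sE (E (~` B) f + z%:C%C *: E B f)%R]_x phi x =
   \int[specm sE (E (~` B) f)]_x phi x +
     (z ^+ 2)%:E * \int[specm sE (E B f)]_x phi x)%E.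
Proof.
move=> mB mphi phi0; have z0 : 0 <= z ^+ 2 by exact: sqr_ge0.
pose m1 := mscale (NngNum z0) (specm sE (E B f)).
rewrite (eq_measure_integral (measure_add (specm sE (E (~` B) f)) m1)).
  by rewrite ge0_integral_measure_add// ge0_integral_mscale.
by move=> A mA _; rewrite [RHS]measure_addE; exact: specm_split.
Qed.

(** The terms k = 1 and k = 3 of the polarization formula are imaginary. *)
Lemma Re_spec_form (phi : R -> R) f g :
  Re (spec_form ip E phi f g) =
  4^-1 * (fine (\int[specm sE (f + g)]_x (phi x)%:E)
        - fine (\int[specm sE (f - g)]_x (phi x)%:E)).
Proof.
have e4 : (4^-1 : R[i]) = (4^-1)%:C%C by rewrite fmorphV rmorph_nat.
have e2 : 'i%C ^+ 2 = -1 :> R[i] by rewrite sqr_i.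
have e3 : 'i%C ^+ 3 = - 'i%C :> R[i] by rewrite exprS sqr_i mulrN1.
rewrite /spec_form e4 Re_realM; congr (_ * _).
pose J h := fine (\int[spec_meas ip E h]_x (phi x)%:E)%E.
rewrite (sum_ord4 (fun k => 'i%C ^+ k * (J (f + 'i%C ^+ k *: g))%:C%C)).
rewrite expr0 expr1 e2 e3 scale1r mul1r scaleN1r mulN1r -!integral_spec_meas.
by rewrite -/(J (f + g)) -/(J (f - g)) !ReD ReN mulNr ReN /=; ring.
Qed.

(** Because |x| <= 1 + x^2 and the measure is finite. *)
Lemma integrable_spec_id f : spec_dom ip E id f ->
  (specm sE f).-integrable setT (EFin \o id).
Proof.
rewrite /spec_dom/= integral_spec_meas => fin2.
apply/integrableP; split; first exact/measurable_EFinP.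
have m2 : measurable_fun [set: T] (fun x : T => (x ^+ 2)%:E).
  by apply/measurable_EFinP; exact: measurable_funX.
apply: (@le_lt_trans _ _ (\int[specm sE f]_x (1 + (x ^+ 2)%:E))%E).
  apply: ge0_le_integral => //.
  - by apply: measurableT_comp => //; exact/measurable_EFinP.
  - by apply: emeasurable_funD => //; exact: measurable_cst.
  - move=> x _ /=; rewrite lee_fin.
    have := sqr_ge0 (`|x| - 1); rewrite -(real_normK (num_real x)).
    have := normr_ge0 x; nra.
rewrite ge0_integralD//; last by move=> x _; rewrite lee_fin sqr_ge0.
rewrite lte_add_pinfty// integral_cst// mul1e.
by rewrite (_ : _ setT = (N (E setT f))%:E) ?ltry//; exact: specmE.
Qed.

Lemma spec_dom_split f B : measurable B -> spec_dom ip E id f ->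
  spec_dom ip E id (E B f) /\ spec_dom ip E id (E (~` B) f).
Proof.
move=> mB; rewrite /spec_dom/= !integral_spec_meas.
rewrite -{1}(spec_compl f mB) addrC -{1}[E B f]scale1r -[1]/(1%:C%C).
rewrite integral_specm_split//; last 2 first.
- by apply/measurable_EFinP; exact: measurable_funX.
- by move=> x; rewrite lee_fin sqr_ge0.
have i0 g : (0 <= \int[specm sE g]_x (x ^+ 2)%:E)%E.
  by apply: integral_ge0 => x _; rewrite lee_fin sqr_ge0.
rewrite expr1n mul1e => h; split; apply: le_lt_trans h.
  by rewrite leeDr.
by rewrite leeDl.
Qed.

(** Put p = E(B) e and q = E(~B) e. The real part of the eigenvalue equation
tested against p compares the measures of e + p = q + 2 p and e - p = q; what
remains is that the measure of p has mean a. The sign of s says on which side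
of a the set B lies. *)
Lemma spec_eigen_oneside (a s : R) e B : measurable B ->
  spec_int ip E id (e, a%:C%C *: e) ->
  (forall x, B x -> 0 < s * (x - a)) -> E B e = 0.
Proof.
move=> mB [/= de he] sB; have mB' := measurableC mB.
set p := E B e; set q := E (~` B) e.
have [dp dq] := spec_dom_split mB de.
have [ip_ iq_] := conj (integrable_spec_id dp) (integrable_spec_id dq).
have meanp : fine (\int[specm sE p]_x x%:E)%E = a * N p.
  have := congr1 (@complex.Re R) (he p dp).
  rewrite Re_ipZ Re_ipC (Re_ip_proj (pE mB)) Re_spec_form.
  have -> : e + p = q + 2%:C%C *: p.
    rewrite -{1}(spec_compl e mB) -/p -/q (_ : 2%:C%C = 1 + 1) ?rmorphD//.
    by rewrite scalerDl scale1r addrAC addrC.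
  have -> : e - p = q by rewrite -{1}(spec_compl e mB) -/p -/q addrAC subrr add0r.
  pose X : T -> \bar R := EFin \o id.
  pose J (phi : T -> \bar R) h := (\int[specm sE h]_x phi x)%E.
  have JE h : J X^\+%E h \is a fin_num ->
      J X^\-%E h \is a fin_num ->
      fine (J X h) =
      fine (J X^\+%E h) - fine (J X^\-%E h).
    by move=> Jp Jn; rewrite /J integralE; exact: fineB.
  have J2 phi : measurable_fun setT phi -> (forall x, 0 <= phi x)%E ->
      J phi q \is a fin_num -> J phi p \is a fin_num ->
      J phi (q + 2%:C%C *: p) \is a fin_num /\
      fine (J phi (q + 2%:C%C *: p)) = fine (J phi q) + 4 * fine (J phi p).
    move=> mphi phi0 fq fp; rewrite /J /q /p integral_specm_split//.
    rewrite -/q -/p -/(J phi q) -/(J phi p); clearbody J.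
    rewrite -(fineK fq) -(fineK fp) -EFinM -EFinD; split => //=.
    by rewrite -natrX.
  have [p1 p2] := conj (integrable_pos_fin_num measurableT ip_)
    (integrable_neg_fin_num measurableT ip_).
  have [q1 q2] := conj (integrable_pos_fin_num measurableT iq_)
    (integrable_neg_fin_num measurableT iq_).
  have mid : measurable_fun setT X.
    exact/measurable_EFinP.
  have [f1 e1] := J2 _ (measurable_funepos mid) (funepos_ge0 _) q1 p1.
  have [f2 e2] := J2 _ (measurable_funeneg mid) (funeneg_ge0 _) q2 p2.
  move=> ->; rewrite -[LHS]/(fine (J X p)) -/(J X q).
  rewrite -/(J X (q + 2%:C%C *: p)).
  by rewrite !JE// e1 e2; clearbody J; field.
have pT : specm sE p setT = (N p)%:E.
  by rewrite specmE//; have [_ -> _] := sE.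
have pB' : specm sE p (~` B) = 0%E.
  by rewrite specmE// spec_orth// ?setICl// sqnorm0.
have icst : (specm sE p).-integrable setT (cst a%:E).
  apply/integrableP; split; first exact: measurable_cst.
  rewrite (_ : (fun x => _) = cst `|a|%:E)// integral_cst//.
  by rewrite [X in (_ * X)%E]pT -EFinM ltry.
have ixa : (specm sE p).-integrable setT (fun x => (x - a)%:E).
  by under eq_fun do rewrite EFinB; exact: integrableB.
(* the integrand is positive on B, so that B has to be a null set *)
have zero : (\int[specm sE p]_(x in B) (s * (x - a))%:E = 0)%E.
  under eq_integral do rewrite EFinM.
  rewrite integralZl//; last exact: integrableS ixa.
  rewrite -[X in integral _ X _](setCK B) -setTD -negligible_integral//.
  under eq_integral do rewrite EFinB.
  rewrite integralB// integral_cst// [X in (_ - (_ * X))%E]pT.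
  rewrite -[X in (X - _)%E]fineK ?integrable_fin_num// meanp.
  by rewrite EFinM subee ?mule0.
suff : specm sE p B = 0%E.
  by rewrite specmE// (projK (pE mB)) => -[]; exact: sqnorm_eq0.
have mf : measurable_fun B (fun x : T => (s * (x - a))%:E).
  apply/measurable_EFinP/measurable_funM => //.
  exact: measurable_funB.
have /(ae_eq_integral_abs _ mB mf) : (\int[specm sE p]_(x in B) `|(s * (x - a))%:E| = 0)%E.
  rewrite -[RHS]zero; apply: eq_integral => x /[!inE] /sB x0.
  by rewrite gee0_abs// lee_fin ltW.
move=> [A [mA A0 BA]].
apply/eqP; rewrite eq_le measure_ge0 andbT -A0 le_measure ?inE//.
move=> x Bx; apply: BA => /= /(_ Bx) [] e0.
by have := sB _ Bx; rewrite e0 ltxx.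
Qed.

(** The complement of a is the union of two open half-lines, each of which is
null for the measure of e. *)
Lemma spec_eigen (a : R) e B : measurable B ->
  spec_int ip E id (e, a%:C%C *: e) -> E B e = if a \in B then e else 0.
Proof.
move=> mB he.
have ma : measurable ([set a] : set T) by exact: measurable_set1.
have gt0 : E `]a, +oo[%classic e = 0.
  apply: (spec_eigen_oneside (s := 1) _ he) => [|x /=]; first exact: measurable_itv.
  by rewrite in_itv/= andbT mul1r subr_gt0.
have lt0 : E `]-oo, a[%classic e = 0.
  apply: (spec_eigen_oneside (s := -1) _ he) => [|x /=]; first exact: measurable_itv.
  by rewrite in_itv/= mulN1r opprB subr_gt0.
have mG : measurable (`]a, +oo[%classic : set T) by exact: measurable_itv.
have mL : measurable (`]-oo, a[%classic : set T) by exact: measurable_itv.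
have off C : measurable C -> ~ C a -> E C e = 0.
  move=> mC Ca; apply: (@spec_eq0_sub e (`]a, +oo[%classic `|` `]-oo, a[%classic)) => //.
  - exact: measurableU.
  - move=> x Cx; have : x != a by apply: contra_not_neq Ca => <-.
    by rewrite neq_lt => /orP[h|h]; [right|left]; rewrite /= in_itv/= ?andbT.
  rewrite specU// ?gt0 ?lt0 ?addr0//.
  by apply/seteqP; split => x //= []; rewrite !in_itv/= andbT => /lt_trans/[apply]; rewrite ltxx.
case: ifPn => [/[!inE] aB|/negP aB]; last by apply: off => // h; apply: aB; rewrite inE.
by rewrite -[RHS](spec_compl e mB) (off (~` B)) ?addr0//; exact: measurableC.
Qed.

End spectral_measure.

(** * Multiplication operators on l2 *)

Section l2_points.
Context {R : realType} {I : choiceType}.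
Local Notation C := R[i].
Local Notation Re := complex.Re.
Local Notation Im := complex.Im.
Local Notation normc := ComplexField.Normc.normc.
Implicit Types (f g : l2 I : lmodType R[i]) (i j : I).

Lemma l2_ext f g : (forall i, f i = g i) -> f = g.
Proof. by move=> fg; apply: val_inj; apply/funext. Qed.

Lemma l2_summable f : rsummable (fun i => normc (f i) ^+ 2).
Proof. exact/l2_predP/l2_funP. Qed.

Definition mkl2 (h : I -> C) (sh : rsummable (fun i => normc (h i) ^+ 2)) :
  l2 I := L2 ((l2_predP h).2 sh).


Lemma normc_real (a : R) : normc a%:C%C = `|a|.
Proof. by rewrite /= expr0n addr0 sqrtr_sqr. Qed.


Lemma esum_single (p : I -> \bar R) i : (forall j, 0 <= p j)%E ->
  (forall j, j != i -> p j = 0%E) -> (\esum_(j in [set: I]) p j = p i)%E.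
Proof.
move=> p0 pi; rewrite (esumID [set i])// setTI esum_set1// esum1 ?adde0//.
by move=> j [_] /= /eqP; exact: pi.
Qed.

Lemma rsum_single (a : I -> R) i : (forall j, j != i -> a j = 0) ->
  rsum a = a i.
Proof.
move=> ai; rewrite /rsum !(@esum_single _ i).
- by rewrite -[LHS]/(fine (((EFin \o a)^\+ \- (EFin \o a)^\-)%E i)) -funeposneg.
- by move=> j; exact: funeneg_ge0.
- by move=> j /ai e; rewrite funenegE /= e oppr0 maxxx.
- by move=> j; exact: funepos_ge0.
- by move=> j /ai e; rewrite funeposE /= e maxxx.
Qed.

Lemma csum_single (z : I -> C) i : (forall j, j != i -> z j = 0) ->
  csum z = z i.
Proof.
move=> zi; rewrite /csum !(@rsum_single _ i); first by case: (z i).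
- by move=> j /zi ->.
- by move=> j /zi ->.
Qed.

Lemma rsummable0 : rsummable (fun _ : I => 0 : R).
Proof. by rewrite /rsummable /summable esum1 ?ltry// => i _ /=; rewrite normr0. Qed.

Lemma csum_real (a : I -> R) : csum (fun i => (a i)%:C%C) = (rsum a)%:C%C.
Proof.
rewrite /csum; congr Complex => /=.
rewrite -[RHS](mul0r (rsum (fun _ : I => 0 : R))) -rsumZ; last exact: rsummable0.
by congr rsum; apply/funext => i; rewrite mul0r.
Qed.

Lemma csummable_real (a : I -> R) : rsummable a -> csummable (fun i => (a i)%:C%C).
Proof. by split=> //=; exact: rsummable0. Qed.

Lemma point_summable i :
  rsummable (fun j => normc ((j == i)%:R : C) ^+ 2).
Proof.
rewrite /rsummable /summable (@esum_single _ i) ?ltry//.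
move=> j /negbTE ji; rewrite -[LHS]/(`|(normc ((j == i)%:R : C) ^+ 2)%:E|)%E ji.
by rewrite ComplexField.Normc.normc0 expr0n abse0.
Qed.

(** The standard orthonormal basis. *)
Definition l2_point i : l2 I := mkl2 (point_summable i).

Lemma l2_pointE i j : l2_point i j = (j == i)%:R.
Proof. by []. Qed.

Lemma l2_dot_point f i : l2_dot f (l2_point i) = f i.
Proof.
rewrite /l2_dot (@csum_single _ i) /= ?eqxx ?rmorph1 ?mulr1//.
by move=> j /negbTE ->; rewrite rmorph0 mulr0.
Qed.

Lemma sqnorm_l2 f : sqnorm (@l2_dot R I) f = rsum (fun i => normc (f i) ^+ 2).
Proof.
rewrite /sqnorm /l2_dot /csum /=; congr rsum; apply/funext => i.
by rewrite sqr_normcE; case: (f i) => a b /=; ring.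
Qed.

End l2_points.

Section multiplication.
Context {R : realType} {I : choiceType}.
Local Notation C := R[i].
Local Notation Re := complex.Re.
Local Notation Im := complex.Im.
Local Notation normc := ComplexField.Normc.normc.
Local Notation T := (measurableTypeR R).
Local Notation H := (l2 I : lmodType R[i]).
Local Notation dot := (@l2_dot R I).
Implicit Types (f g : H) (w : I -> R) (B : set T).

Definition mul_op w : operator H :=
  [set p : l2 I * l2 I | forall i, p.2 i = (w i)%:C%C * p.1 i].

Lemma mul_opP w f g : mul_op w (f, g) <-> forall i, g i = (w i)%:C%C * f i.
Proof. by []. Qed.

Lemma mul_op_point w i : mul_op w (l2_point i : H, (w i)%:C%C *: l2_point i).
Proof.
apply/mul_opP => j; rewrite -[LHS]/((w i)%:C%C * l2_point i j) l2_pointE.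
by case: eqVneq => [->//|_]; rewrite !mulr0.
Qed.

Lemma restr_summable w B f :
  rsummable (fun i => normc (if w i \in B then f i else 0) ^+ 2).
Proof.
apply: le_rsummable (l2_summable f) => i; case: ifP => // _.
by rewrite ComplexField.Normc.normc0 expr0n normr0.
Qed.

Definition restr w B f : H := mkl2 (restr_summable w B f).

Lemma restrE w B f i : restr w B f i = if w i \in B then f i else 0.
Proof. by []. Qed.

Definition diagonal w (E : set T -> H -> H) := forall B, measurable B ->
  forall f i, E B f i = if w i \in B then f i else 0.

Lemma restr_diagonal w : diagonal w (restr w). Proof. by []. Qed.

(** The points are eigenvectors, so E(B) fixes or kills each of them; the other
vectors follow because E(B) is selfadjoint. *)
Lemma diagonal_spec w (E : set T -> H -> H) : spectral_measure dot E ->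
  mul_op w = spec_int dot E id -> diagonal w E.
Proof.
move=> sE wE B mB f i; have [/(_ B mB) pB _ _] := sE.
have he : spec_int dot E id (l2_point i, (w i)%:C%C *: l2_point i).
  by rewrite -wE; exact: mul_op_point.
rewrite -(l2_dot_point (E B f)) (proj_adj pB) (spec_eigen sE mB he).
by case: ifP => _; [exact: l2_dot_point | exact: linear0r].
Qed.

(** Factoring w through nat makes the measures of vectors countable sums of
point masses, whatever the cardinality of the index set. *)
Section countable_range.
Variables (w : I -> R) (s : I -> nat) (x : nat -> R).
Hypothesis wE : forall i, w i = x (s i).

Let fiber f n i : R := if s i == n then normc (f i) ^+ 2 else 0.
Let fiber_ge0 f n i : 0 <= fiber f n i.
Proof. by rewrite /fiber; case: ifP => // _; exact: sqr_ge0. Qed.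

Definition fiber_mass f n : R := fine (\esum_(i in [set: I]) (fiber f n i)%:E).

Let fiber_massE f n : (fiber_mass f n)%:E = \esum_(i in [set: I]) (fiber f n i)%:E.
Proof.
rewrite /fiber_mass fineK// esum_ge0_finE//.
apply: le_rsummable (l2_summable f) => i; rewrite /fiber; case: ifP => // _.
by rewrite normr0.
Qed.

Lemma fiber_mass_ge0 f n : 0 <= fiber_mass f n.
Proof. by rewrite -lee_fin fiber_massE esum_ge0// => i _; rewrite lee_fin. Qed.

Lemma esum_fiber f (psi : R -> R) : (forall y, 0 <= psi y) ->
  \esum_(i in [set: I]) (psi (w i) * normc (f i) ^+ 2)%:E =
  (\sum_(n <oo) (fiber_mass f n)%:E * (psi (x n))%:E)%E.
Proof.
move=> psi0.
have U : [set: I] = \bigcup_(n in [set: nat]) (s @^-1` [set n]).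
  by apply/seteqP; split => // i _; exists (s i).
have a0 i : (0 <= (psi (w i) * normc (f i) ^+ 2)%:E)%E.
  by rewrite lee_fin mulr_ge0// sqr_ge0.
rewrite nneseries_esumT; last first.
  by move=> n; rewrite -EFinM lee_fin mulr_ge0// fiber_mass_ge0.
rewrite U esum_bigcupT//; last first.
  by move=> i j _ _ [k [/= <- <-]].
apply: eq_esum => n _; rewrite muleC fiber_massE -esumZ// esum_mkcond.
apply: eq_esum => i _; rewrite /fiber; case: eqVneq => sin.
  by rewrite mem_set//= wE sin.
by rewrite memNset ?mulr0//=; exact/eqP.
Qed.

Definition atomic f : nat -> {measure set T -> \bar R} := fun n =>
  mscale (NngNum (fiber_mass_ge0 f n)) (\d_ (x n : T)).

Lemma spec_meas_diagonal (E : set T -> H -> H) f B : (forall i, E B f i = if w i \in B then f i else 0) ->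
  spec_meas dot E f B = mseries (atomic f) 0 B.
Proof.
move=> dE; pose psi (y : R) : R := \1_B y.
have psi0 y : 0 <= psi y by rewrite /psi indicE.
rewrite /spec_meas /l2_dot /csum /=.
rewrite (_ : (fun i => _) = fun i => psi (w i) * normc (f i) ^+ 2); last first.
  apply/funext => i; rewrite dE /psi indicE sqr_normcE.
  by case: ifP => _; case: (f i) => a b /=; ring.
rewrite rsum_ge0; last 2 first.
- by move=> i; rewrite mulr_ge0// sqr_ge0.
- apply: le_rsummable (l2_summable f) => i.
  by rewrite /psi indicE; case: (_ \in _); rewrite ?mul1r// mul0r normr0.
rewrite fineK; last first.
  apply: esum_ge0_finE => [i|]; first by rewrite mulr_ge0// sqr_ge0.
  apply: le_rsummable (l2_summable f) => i.
  by rewrite /psi indicE; case: (_ \in _); rewrite ?mul1r// mul0r normr0.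
by rewrite esum_fiber.
Qed.

Lemma restr_spectral : spectral_measure dot (restr w).
Proof.
split.
- move=> B _; split.
  + move=> c f g; apply: l2_ext => i.
    rewrite -[RHS]/(c * restr w B f i + restr w B g i) !restrE.
    by case: ifP => _; rewrite ?mulr0 ?addr0.
  + by move=> f; apply: l2_ext => i; rewrite !restrE; case: (_ \in _).
  + move=> f g; rewrite /l2_dot; congr csum; apply/funext => i.
    by rewrite !restrE; case: (_ \in _); rewrite ?rmorph0 ?mul0r ?mulr0.
- by apply/funext => f; apply: l2_ext => i /=; rewrite in_setT.
- move=> f; rewrite (_ : spec_meas _ _ _ = mseries (atomic f) 0).
    exact: measure_semi_sigma_additive.
  by apply/funext => B; rewrite spec_meas_diagonal.
Qed.

Section calculus.
Variables (E : set T -> H -> H) (phi : T -> R).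
Hypothesis dE : diagonal w E.
Hypothesis mphi : measurable_fun setT phi.

Lemma integral_diagonal_ge0 f (psi : T -> R) : measurable_fun setT psi ->
  (forall y, 0 <= psi y) ->
  (\int[mseries (atomic f) 0]_y (psi y)%:E =
   \esum_(i in [set: I]) (psi (w i) * normc (f i) ^+ 2)%:E)%E.
Proof.
move=> mpsi psi0; have mE : measurable_fun setT (EFin \o psi).
  exact/measurable_EFinP.
rewrite ge0_integral_measure_series//; last by move=> y _; rewrite lee_fin.
rewrite (esum_fiber f psi0).
apply: eq_eseriesr => n _; rewrite ge0_integral_mscale//; last by move=> y _; rewrite lee_fin.
by rewrite integral_dirac// diracE in_setT mul1e.
Qed.

(** As a difference of sums of positive and negative parts, the equality holds
for every f, and its right-hand side is what [rsum] is made of. *)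
Lemma integral_diagonal f :
  (\int[spec_meas dot E f]_y (phi y)%:E =
   \esum_(i in [set: I]) ((EFin \o (fun i => phi (w i) * normc (f i) ^+ 2)%R)^\+) i -
   \esum_(i in [set: I]) ((EFin \o (fun i => phi (w i) * normc (f i) ^+ 2)%R)^\-) i)%E.
Proof.
rewrite (@eq_setfun_integral _ _ _ _ (mseries (atomic f) 0)); last first.
  by move=> A mA; apply: spec_meas_diagonal => i; rewrite dE.
rewrite integralE; congr (_ - _)%E.
  rewrite (eq_integral (fun y => (Num.max (phi y) 0)%:E)); last first.
    by move=> y _; rewrite funeposE EFin_max.
  rewrite integral_diagonal_ge0//; last 2 first.
  - exact: measurable_maxr.
  - by move=> y; rewrite le_max lexx orbT.
  apply: eq_esum => i _; rewrite funeposE /= -EFin_max.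
  by rewrite maxr_pMl ?sqr_ge0// mul0r.
rewrite (eq_integral (fun y => (Num.max (- phi y) 0)%:E)); last first.
  by move=> y _; rewrite funenegE EFin_max.
rewrite integral_diagonal_ge0//; last 2 first.
- by apply: measurable_maxr => //; exact: measurableT_comp.
- by move=> y; rewrite le_max lexx orbT.
apply: eq_esum => i _; rewrite funenegE /= -EFin_max.
by rewrite maxr_pMl ?sqr_ge0// mul0r mulNr.
Qed.


Lemma spec_dom_diagonal f : spec_dom dot E phi f <->
  rsummable (fun i => phi (w i) ^+ 2 * normc (f i) ^+ 2).
Proof.
rewrite /spec_dom /= /rsummable /summable.
rewrite (@eq_setfun_integral _ _ _ _ (mseries (atomic f) 0)); last first.
  by move=> A mA; apply: spec_meas_diagonal => i; rewrite dE.
rewrite (integral_diagonal_ge0 f (psi := fun y => phi y ^+ 2)); last 2 first.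
- exact: measurable_funX.
- by move=> y; exact: sqr_ge0.
rewrite (_ : (\esum_(i in _) `|_|)%E =
   \esum_(i in [set: I]) (phi (w i) ^+ 2 * normc (f i) ^+ 2)%:E)//.
by apply: eq_esum => i _ /=; rewrite ger0_norm// mulr_ge0// sqr_ge0.
Qed.

Lemma fine_integral_diagonal f :
  fine (\int[spec_meas dot E f]_y (phi y)%:E)%E =
  rsum (fun i => phi (w i) * normc (f i) ^+ 2).
Proof. by rewrite integral_diagonal. Qed.

Let sqr_normc_lin (k : nat) (f g : H) i :
  normc ((f + 'i%C ^+ k *: g) i) ^+ 2 <= 2 * normc (f i) ^+ 2 + 2 * normc (g i) ^+ 2.
Proof.
have -> : (f + 'i%C ^+ k *: g) i = f i + 'i%C ^+ k * g i by [].
have -> : normc (g i) = normc ('i%C ^+ k * g i).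
  rewrite ComplexField.Normc.normcM; suff -> : normc ('i%C ^+ k : C) = 1 by rewrite mul1r.
  elim: k => [|k IH]; first by rewrite expr0 ComplexField.Normc.normc1.
  rewrite exprS ComplexField.Normc.normcM IH mulr1.
  by rewrite /= expr0n add0r expr1n sqrtr1.
rewrite !sqr_normcE ReD ImD.
set a := Re (f i); set b := Im (f i); set c := Re _; set d := Im _.
have := addr_ge0 (sqr_ge0 (a - c)) (sqr_ge0 (b - d)); nra.
Qed.

(* |phi| <= 1 + phi^2, so the domain controls the integral of phi itself *)
Let summable_lin k (f g : H) : spec_dom dot E phi f -> spec_dom dot E phi g ->
  rsummable (fun i => phi (w i) * normc ((f + 'i%C ^+ k *: g) i) ^+ 2).
Proof.
move=> /spec_dom_diagonal df /spec_dom_diagonal dg.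
have s1 := rsummableD (l2_summable f) df.
have s2 := rsummableD (l2_summable g) dg.
apply: le_rsummable (rsummableZ 2 (rsummableD s1 s2)) => i.
rewrite normrM [X in _ * X <= _]ger0_norm ?sqr_ge0//.
have pf := sqr_ge0 (normc (f i)); have pg := sqr_ge0 (normc (g i)).
have h1 : `|phi (w i)| <= 1 + phi (w i) ^+ 2.
  rewrite -(real_normK (num_real (phi (w i)))).
  have := sqr_ge0 (`|phi (w i)| - 1); have := normr_ge0 (phi (w i)); nra.
have := ler_pM (normr_ge0 _) (sqr_ge0 _) h1 (sqr_normc_lin k f g i).
move=> /le_trans; apply; apply: le_trans (ler_norm _).
by rewrite le_eqVlt; apply/orP; left; apply/eqP; ring.
Qed.

(** Coordinatewise this is the polarization identity for complex numbers. *)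
Lemma spec_form_diagonal (f g : H) : spec_dom dot E phi f -> spec_dom dot E phi g ->
  spec_form dot E phi f g = csum (fun i => (phi (w i))%:C%C * f i * conjC (g i)).
Proof.
move=> df dg; pose F k i := phi (w i) * normc ((f + 'i%C ^+ k *: g) i) ^+ 2.
have sF k : csummable (fun i => (F k i)%:C%C) by exact/csummable_real/summable_lin.
have csZ (c : C) (z : I -> C) : csummable z -> csummable (fun i : I => c * z i).
  move=> [zr zi]; split.
    rewrite (_ : (fun i => _) = fun i => Re c * Re (z i) + (- Im c) * Im (z i)).
      by apply: rsummableD; exact: rsummableZ.
    by apply/funext => i; case: c (z i) => ? ? [? ?] /=; rewrite mulNr.
  rewrite (_ : (fun i => _) = fun i => Re c * Im (z i) + Im c * Re (z i)).
    by apply: rsummableD; exact: rsummableZ.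
  by apply/funext => i; case: c (z i) => ? ? [].
have csD (z z' : I -> C) : csummable z -> csummable z' ->
    csummable (fun i : I => z i + z' i).
  move=> [zr zi] [zr' zi']; split.
    rewrite (_ : (fun i => _) = fun i => Re (z i) + Re (z' i)).
      exact: rsummableD.
    by apply/funext => i; rewrite ReD.
  rewrite (_ : (fun i => _) = fun i => Im (z i) + Im (z' i)).
    exact: rsummableD.
  by apply/funext => i; rewrite ImD.
have sG k : csummable (fun i => 'i%C ^+ k * (F k i)%:C%C) by exact: csZ.
rewrite /spec_form.
pose G k := csum (fun i => 'i%C ^+ k * (F k i)%:C%C).
rewrite (eq_bigr (fun k : 'I_4 => G k)); last first.
  by move=> k _; rewrite /G csumZ// csum_real fine_integral_diagonal.
rewrite (sum_ord4 G) /G.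
have s01 := csD _ _ (sG 0%N) (sG 1%N).
have s02 := csD _ _ s01 (sG 2%N).
have s03 := csD _ _ s02 (sG 3%N).
rewrite -(csumD (sG 0%N) (sG 1%N)) -(csumD s01 (sG 2%N)) -(csumD s02 (sG 3%N)).
rewrite -(csumZ _ s03).
congr csum; apply/funext => i; rewrite /F.
have e k : (f + 'i%C ^+ k *: g) i = f i + 'i%C ^+ k * g i by [].
have e2 : 'i%C ^+ 2 = -1 :> C by rewrite sqr_i.
have e3 : 'i%C ^+ 3 = - 'i%C :> C by rewrite exprS sqr_i mulrN1.
have e4 : (4^-1 : C) = (4^-1)%:C%C by rewrite fmorphV rmorph_nat.
rewrite e4 !e !expr0 !expr1 !e2 !e3 !sqr_normcE.
by case: (f i) (g i) => a b [c d]; apply/eqP; rewrite eq_complex /=;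
  apply/andP; split; apply/eqP; field.
Qed.

(** Testing the defining equation of the integral against the points reads
off the coordinates. *)
Lemma spec_int_diagonal : spec_int dot E phi = mul_op (phi \o w).
Proof.
apply/seteqP; split => -[f h] /=.
  move=> [df dh] i; have di : spec_dom dot E phi (l2_point i).
    apply/spec_dom_diagonal; apply: le_rsummable (rsummableZ (phi (w i) ^+ 2) (point_summable i)) => j.
    rewrite l2_pointE; case: eqVneq => [->//|_].
    by rewrite ComplexField.Normc.normc0 expr0n !mulr0.
  rewrite -(l2_dot_point h) dh// spec_form_diagonal// (@csum_single _ _ _ i).
    by rewrite l2_pointE eqxx rmorph1 mulr1.
  move=> j /negbTE ji; rewrite l2_pointE ji.
  by rewrite rmorph0 mulr0.
move=> fh; have df : spec_dom dot E phi f.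
  apply/spec_dom_diagonal; apply: le_rsummable (l2_summable h) => i.
  by rewrite fh ComplexField.Normc.normcM normc_real exprMn real_normK ?num_real.
split=> // g dg; rewrite spec_form_diagonal//.
by congr csum; apply/funext => i; rewrite fh.
Qed.

End calculus.

(** Every spectral measure of the multiplication by w is diagonal, so the
choice made in the definition of the power does not matter. *)
Lemma oppow_mul_op (r : R) : (forall i, 0 <= w i) ->
  oppow dot (mul_op w) r = mul_op (fun i => w i `^ r).
Proof.
move=> w0; have mr : measurable_fun setT (fun y : T => y `^ r).
  exact: measurable_powR.
have mid : measurable_fun setT (id : T -> R) by exact: measurable_id.
rewrite /oppow; case: xgetP => [B -> [E [sE _ mE ->]]|/(_ (mul_op (fun i => w i `^ r))) []].
  by rewrite (spec_int_diagonal (diagonal_spec sE mE) mr).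
exists (restr w); split.
- exact: restr_spectral.
- apply/funext => f; apply: l2_ext => i.
  by rewrite restrE mem_set//=.
- by rewrite (spec_int_diagonal (restr_diagonal w) mid).
- by rewrite (spec_int_diagonal (restr_diagonal w) mr).
Qed.

End countable_range.
End multiplication.

(** * The tree of sequences *)

Section integer_bounds.
Implicit Types (A : set int) (m : int).

Lemma int_minimum A b : A !=set0 -> lbound A b -> exists2 m, A m & lbound A m.
Proof.
move=> [a Aa] bA; pose P (k : nat) := `[< A (b + k%:Z) >].
have exP : exists k, P k.
  exists `|a - b|%N; apply/asboolP.
  by have ab := bA _ Aa; rewrite gez0_abs ?subr_ge0// subrKC.
have [k /asboolP Ak kmin] := ex_minnP exP.
exists (b + k%:Z) => // y Ay; have by_ := bA _ Ay.
have /kmin : P `|y - b|%N.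
  by apply/asboolP; rewrite gez0_abs ?subr_ge0// subrKC.
by lia.
Qed.

Lemma int_maximum A b : A !=set0 -> ubound A b -> exists2 m, A m & ubound A m.
Proof.
move=> [a Aa] bA; have [] := @int_minimum [set y | A (- y)] (- b).
- by exists (- a); rewrite /= opprK.
- by move=> y /= /bA; rewrite lerNl.
move=> m Am mA; exists (- m) => // y Ay.
by rewrite lerNr; apply: mA => /=; rewrite opprK.
Qed.

Lemma supremum_max A m : A m -> ubound A m -> supremum 0 A = m.
Proof.
move=> Am mA; rewrite /supremum ifF; last first.
  by apply/negbTE/set0P; exists m.
apply: xget_subset1; last exact: is_subset1_supremums.
by split=> // y; apply.
Qed.

Lemma infimum_min A m : A m -> lbound A m -> infimum 0 A = m.
Proof.
move=> Am mA; rewrite /infimum ifF; last first.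
  by apply/negbTE/set0P; exists m.
apply: xget_subset1; last exact: is_subset1_infimums.
by split=> // y; apply.
Qed.

End integer_bounds.

Section tree.
Implicit Types (u v : vertex) (k : nat) (n : int).
Local Notation M v := (seq_M (val v)).
Local Notation m v := (seq_m (val v)).

Lemma seq_M_eq (f : int -> int) (b : int) :
  (forall n, (-1 < f n) = (n <= b)) -> seq_M f = b.
Proof.
move=> fb; apply: supremum_max; first by rewrite /= fb.
by move=> n /=; rewrite fb.
Qed.

Lemma vertex_gtN1 v n : (-1 < val v n) = (n <= M v).
Proof.
have [_ [b vb] [c vc] vM] := set_mem (valP v).
apply/idP/idP => [vn|]; last exact: vM.
have [p vp pmax] : exists2 p, -1 < val v p & ubound [set n | -1 < val v n] p.
  by apply: int_maximum vc; exists n.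
by rewrite /seq_M (supremum_max vp pmax); exact: pmax.
Qed.

Lemma vertex_geN1 v n : -1 <= val v n.
Proof. by have [+ _ _ _] := set_mem (valP v); apply. Qed.

Lemma vertex_out v n : M v < n -> val v n = -1.
Proof.
move=> h; have := vertex_gtN1 v n; have := vertex_geN1 v n; lia.
Qed.

Lemma vertex_ge0 v n : n <= M v -> 0 <= val v n.
Proof. by rewrite -vertex_gtN1; lia. Qed.

Lemma seq_m_prop v : m v < M v /\ forall n, n < m v -> val v n = 0.
Proof.
have [_ [b vb] _ _] := set_mem (valP v).
have vM : val v (M v + 1) != 0 by rewrite vertex_out//; lia.
have [p vp pmin] : exists2 p, val v p != 0 & lbound [set n | val v n != 0] p.
  by apply: int_minimum vb; exists (M v + 1).
have -> : m v = p - 2 by rewrite /seq_m (infimum_min vp pmin).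
split; first by have := pmin _ vM; lia.
move=> n np; apply/eqP/negPn/negP => /pmin; lia.
Qed.

Lemma vertexI (f : int -> int) (b c : int) : (forall n, -1 <= f n) ->
  (forall n, (-1 < f n) = (n <= b)) -> (forall n, n < c -> f n = 0) ->
  vertices f.
Proof.
move=> f1 fb fc; split=> //.
- exists c => n /= fn; rewrite leNgt; apply/negP => /fc; exact/eqP.
- by exists b => n /=; rewrite fb.
- by move=> n; rewrite (seq_M_eq fb) fb.
Qed.

Definition mk_vertex (f : int -> int) (vf : vertices f) : vertex :=
  exist (fun f => f \in vertices) f (mem_set vf).

Definition child_seq u k n : int := if n == M u + 1 then k%:Z else val u n.

Lemma child_seq_gtN1 u k n : (-1 < child_seq u k n) = (n <= M u + 1).
Proof.
rewrite /child_seq; case: eqVneq => [->|nM]; first by lia.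
by rewrite vertex_gtN1; lia.
Qed.

Lemma child_seq_vertex u k : vertices (child_seq u k).
Proof.
have [mM mu] := seq_m_prop u.
apply: (@vertexI _ (M u + 1) (m u)); first 1 last.
- exact: child_seq_gtN1.
- by move=> n nm; rewrite /child_seq ifF ?mu//; lia.
by move=> n; rewrite /child_seq; case: ifP => _; [lia|exact: vertex_geN1].
Qed.

Definition child u k : vertex := mk_vertex (child_seq_vertex u k).

Lemma child_val u k n : val (child u k) n = if n == M u + 1 then k%:Z else val u n.
Proof. by []. Qed.

Lemma child_M u k : M (child u k) = M u + 1.
Proof. exact: seq_M_eq (child_seq_gtN1 u k). Qed.

Lemma vertex_ext u v : (forall n, val u n = val v n) -> u = v.
Proof. by move=> uv; apply: val_inj; apply/funext. Qed.

Lemma edge_child u k : edge u (child u k).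
Proof.
split; first exact: child_M.
by move=> n nM; rewrite child_val ifF//; lia.
Qed.

Lemma edge_parent_inj u u' v : edge u v -> edge u' v -> u = u'.
Proof.
move=> [Mu uv] [Mu' uv']; have e : M u = M u' by lia.
apply: vertex_ext => n; have [nM|nM] := leP n (M u).
  by rewrite uv// uv'// -e.
by rewrite !vertex_out// -e.
Qed.

Lemma edgeE u v : edge u v -> v = child u `|val v (M v)|%N.
Proof.
move=> [Mv uv]; apply: vertex_ext => n; rewrite child_val.
case: eqVneq => [->|nM].
  by rewrite -Mv gez0_abs// vertex_ge0.
have [nu|un] := leP n (M u); first by rewrite uv.
by rewrite !vertex_out//; lia.
Qed.

Lemma parent_child u k : parent (child u k) = u.
Proof.
apply: xget_unique; first exact: edge_child.
by move=> v vu; exact: edge_parent_inj vu (edge_child u k).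
Qed.

Lemma has_parent v : exists u, edge u v.
Proof.
pose f n : int := if n == M v then -1 else val v n.
have fE n : (-1 < f n) = (n <= M v - 1).
  rewrite /f; case: eqVneq => [->|nM]; first by lia.
  by rewrite vertex_gtN1; lia.
have [mM mv] := seq_m_prop v.
have vf : vertices f.
  apply: (@vertexI _ (M v - 1) (m v)) => // n.
    by rewrite /f; case: ifP => // _; exact: vertex_geN1.
  by move=> nm; rewrite /f ifF ?mv//; lia.
have Mf : seq_M f = M v - 1 by exact: seq_M_eq fE.
exists (mk_vertex vf); split; rewrite -[val (mk_vertex vf)]/f Mf; first by lia.
by move=> n nM; rewrite /f ifF//; lia.
Qed.

Lemma childP v : exists u k, v = child u k.
Proof.
have [u /edgeE ->] := has_parent v.
by exists u, `|val v (M v)|%N.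
Qed.

Lemma child_inj u k l : child u k = child u l -> k = l.
Proof.
move=> /(congr1 (fun v : vertex => val v (M u + 1))).
by rewrite !child_val eqxx => -[].
Qed.

(** Below m(v) the sequence vanishes, so the exponent of the weight is the
sum over any long enough stretch ending at M(v) - 1. *)
Definition exponent v : int := \sum_(k < `|M v - m v|%N) val v (m v + k%:Z).

Lemma exponent_tail v N : (`|M v - m v| <= N)%N ->
  exponent v = \sum_(i < N) val v (M v - 1 - i%:Z).
Proof.
have [mM mv] := seq_m_prop v.
set K := `|M v - m v|%N => KN.
rewrite -(subnKC KN) big_split_ord [X in _ = _ + X]big1 ?addr0; last first.
  by move=> i _; apply: mv; rewrite -[nat_of_ord (rshift _ _)]/(K + i)%N /K; lia.
rewrite /exponent -/K (reindex_inj rev_ord_inj); apply: eq_bigr => i _.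
rewrite -[nat_of_ord (rev_ord i)]/(K - i.+1)%N -[nat_of_ord (lshift _ _)]/(nat_of_ord i).
by congr (val v _); have := ltn_ord i; rewrite /K; lia.
Qed.

(** The sum of all the entries of u up to M(u); all of them are nonnegative, so
nothing is lost in the absolute value. *)
Definition entry_sum u : nat := `|(exponent u + val u (M u))%R|%N.

Lemma exponent_child u k : exponent (child u k) = (entry_sum u)%:Z.
Proof.
have [mM mu] := seq_m_prop u.
pose K := `|M u - m u|%N; pose N := (K + `|M (child u k) - m (child u k)|)%N.
have e0 : exponent u + val u (M u) = \sum_(i < N.+1) val u (M u - i%:Z).
  rewrite big_ord_recl subr0 addrC (@exponent_tail u N) ?leq_addr//.
  congr (_ + _); apply: eq_bigr => i _; congr (val u _).
  by rewrite -[nat_of_ord (lift _ _)]/i.+1; lia.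
have e1 : exponent (child u k) = \sum_(i < N.+1) val u (M u - i%:Z).
  rewrite (@exponent_tail _ N.+1); last by rewrite /N; lia.
  apply: eq_bigr => i _; rewrite child_M child_val ifF; last by lia.
  by congr (val u _); lia.
rewrite e1 /entry_sum e0 gez0_abs//; apply: sumr_ge0 => i _.
by apply: vertex_ge0; lia.
Qed.

Lemma entry_sum_child u k : entry_sum (child u k) = (entry_sum u + k)%N.
Proof. by rewrite /entry_sum exponent_child child_M child_val eqxx. Qed.

Lemma weight_child (R : realType) u k :
  weight R (child u k) = 2 ^+ entry_sum u / k.+1%:R.
Proof.
rewrite /weight -/(exponent (child u k)) exponent_child.
rewrite child_M child_val eqxx; congr (_ / _).
by rewrite -[_ + 1]/((k + 1)%:Z) addn1.
Qed.

Lemma children_bij u : set_bij [set: nat] (children u) (child u).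
Proof.
split=> [k _|k l _ _|v /edgeE ->]; first exact: edge_child.
  exact: child_inj.
by exists `|val v (M v)|%N.
Qed.

(** Every vertex is a child of exactly one vertex. *)
Lemma esum_tree (R : realType) (a : vertex -> \bar R) : (forall v, 0 <= a v)%E ->
  (\esum_(v in [set: vertex]) a v =
   \esum_(u in [set: vertex]) \esum_(k in [set: nat]) a (child u k))%E.
Proof.
move=> a0; rewrite esum_esum//.
apply: (@reindex_esum _ _ _ _ _ (fun p : vertex * nat => child p.1 p.2)); split.
- by [].
- move=> [u k] [u' k'] _ _ /= e.
  have uu : u = u' by rewrite -(parent_child u k) e parent_child.
  by move: e; rewrite -uu => /child_inj ->.
- by move=> v _; have [u [k ->]] := childP v; exists (u, k).
Qed.

End tree.

(** * The weighted shift *)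

Section shift.
Variable R : realType.
Local Notation C := R[i].
Local Notation Re := complex.Re.
Local Notation Im := complex.Im.
Local Notation normc := ComplexField.Normc.normc.
Local Notation H := (l2 vertex : lmodType R[i]).
Local Notation dot := (@l2_dot R vertex).
Local Notation weight := (@weight R).
Local Notation S := (weighted_shift weight).
Implicit Types (f g h : H) (u v : vertex).

Let inv_sq (k : nat) : R := k.+1%:R^-1 ^+ 2.
Let inv_sq_ge0 k : 0 <= inv_sq k. Proof. exact: sqr_ge0. Qed.

(** By induction from 1 / (n + 1)^2 <= 1 / n - 1 / (n + 1). *)
Lemma inv_sq_partial n : \sum_(0 <= k < n.+1) inv_sq k <= 2 - n.+1%:R^-1.
Proof.
elim: n => [|n IH]; first by rewrite big_nat1 /inv_sq invr1 expr1n; lra.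
rewrite big_nat_recr//=; apply: le_trans (lerD IH (lexx _)) _.
rewrite -subr_ge0 /inv_sq.
have n0 : 0 <= n%:R :> R by rewrite ler0n.
have -> : (n.+1%:R : R) = n%:R + 1 by rewrite -natr1.
have -> : (n.+2%:R : R) = n%:R + 2 by rewrite -[n.+2]addn2 natrD.
set a := n%:R.
have -> : 2 - (a + 2)^-1 - (2 - (a + 1)^-1 + (a + 2)^-1 ^+ 2) =
  ((a + 1) * (a + 2) ^+ 2)^-1.
  by field; rewrite !gt_eqF// /a; lra.
by rewrite invr_ge0 mulr_ge0 ?sqr_ge0//; lra.
Qed.

Lemma inv_sq_summable : rsummable inv_sq.
Proof.
rewrite /rsummable /summable (eq_esum (b := fun k => (inv_sq k)%:E)); last first.
  by move=> k _ /=; rewrite ger0_norm.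
rewrite -nneseries_esumT; last by move=> k; rewrite lee_fin.
apply: (@le_lt_trans _ _ 2%:E); last exact: ltry.
apply: lime_le; first by apply: is_cvg_nneseries => k _ _; rewrite lee_fin.
apply: nearW => -[|n]; first by rewrite big_geq// lee_fin.
rewrite sumEFin lee_fin (le_trans (inv_sq_partial n))//.
by rewrite lerBlDr lerDl invr_ge0.
Qed.

Definition zeta2 : R := fine (\esum_(k in [set: nat]) (inv_sq k)%:E).

Lemma zeta2E : zeta2%:E = (\esum_(k in [set: nat]) (inv_sq k)%:E)%E.
Proof. by rewrite /zeta2 fineK// esum_ge0_finE//; exact: inv_sq_summable. Qed.

Lemma zeta2_ge1 : 1 <= zeta2.
Proof.
rewrite -lee_fin zeta2E (esumID [set 0%N])//; last by move=> *; rewrite lee_fin.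
rewrite setTI esum_set1 ?lee_fin// /inv_sq invr1 expr1n leeDl//.
by apply: esum_ge0 => *; rewrite lee_fin.
Qed.

(** The norm of S e_u, by [esum_weight]. *)
Definition modulus u : R := Num.sqrt zeta2 * 2 ^+ entry_sum u.

Lemma modulus_ge1 u : 1 <= modulus u.
Proof.
rewrite -[1]mulr1 ler_pM//; first by rewrite -[1]sqrtr1 ler_wsqrtr// zeta2_ge1.
by rewrite exprn_ege1// ler1n.
Qed.

Lemma modulus_gt0 u : 0 < modulus u.
Proof. exact: lt_le_trans (modulus_ge1 u). Qed.

Lemma modulus_neq0 u : modulus u != 0.
Proof. by rewrite gt_eqF// modulus_gt0. Qed.

Lemma modulus_sqr u : modulus u ^+ 2 = zeta2 * (2 ^+ entry_sum u) ^+ 2.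
Proof. by rewrite exprMn sqr_sqrtr// (le_trans _ zeta2_ge1). Qed.

Lemma modulus_child u n : modulus (child u n) = modulus u * 2 ^+ n.
Proof. by rewrite /modulus entry_sum_child exprD mulrA. Qed.

Lemma esum_weight u :
  (\esum_(v in children u) (`|weight v| ^+ 2)%:E = (modulus u ^+ 2)%:E)%E.
Proof.
rewrite (reindex_esum _ _ _ _ (children_bij u)) modulus_sqr mulrC EFinM zeta2E.
rewrite -esumZ ?sqr_ge0//; apply: eq_esum => n _.
by rewrite weight_child real_normK ?num_real// exprMn.
Qed.

Lemma weight_child_gt0 u n : 0 < weight (child u n).
Proof. by rewrite weight_child divr_gt0// exprn_gt0. Qed.

(** Summation over the tree, one family of siblings at a time. *)
Lemma esum_siblings (p : vertex -> R) : (forall u, 0 <= p u) ->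
  (\esum_(v in [set: vertex]) (weight v ^+ 2 * p (parent v))%:E =
   \esum_(u in [set: vertex]) (modulus u ^+ 2 * p u)%:E)%E.
Proof.
move=> p0; rewrite esum_tree; last by move=> v; rewrite lee_fin mulr_ge0// sqr_ge0.
apply: eq_esum => u _; rewrite mulrC EFinM -esum_weight.
rewrite (reindex_esum _ _ _ _ (children_bij u)) -esumZ//; apply: eq_esum => n _.
by rewrite parent_child mulrC real_normK ?num_real.
Qed.

Lemma rsum_siblings (a : vertex -> R) :
  rsum (fun v => weight v ^+ 2 * a (parent v)) =
  rsum (fun u => modulus u ^+ 2 * a u).
Proof.
have maxZ (c y : R) : (maxe (c ^+ 2 * y)%:E 0 = (c ^+ 2 * Num.max y 0)%:E)%E.
  by rewrite -EFin_max maxr_pMr ?sqr_ge0// mulr0.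
rewrite /rsum; congr (fine (_ - _)%E).
  under eq_esum do rewrite funeposE /= maxZ.
  under [RHS]eq_esum do rewrite funeposE /= maxZ.
  by apply: (esum_siblings (p := fun u => Num.max (a u) 0)) => u; rewrite le_max lexx orbT.
under eq_esum do rewrite funenegE /= -mulrN maxZ.
under [RHS]eq_esum do rewrite funenegE /= -mulrN maxZ.
by apply: (esum_siblings (p := fun u => Num.max (- a u) 0)) => u; rewrite le_max lexx orbT.
Qed.

Lemma csum_siblings (z : vertex -> C) :
  csum (fun v => (weight v ^+ 2)%:C%C * z (parent v)) =
  csum (fun u => (modulus u ^+ 2)%:C%C * z u).
Proof.
have ImZ (c : R) (y : C) : Im (c%:C%C * y) = c * Im y.
  by case: y => ? ? /=; rewrite mul0r addr0.
rewrite /csum; congr Complex.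
  under eq_fun do rewrite Re_realM.
  under [in RHS]eq_fun do rewrite Re_realM.
  exact: (rsum_siblings (fun u => Re (z u))).
under eq_fun do rewrite ImZ.
under [in RHS]eq_fun do rewrite ImZ.
exact: (rsum_siblings (fun u => Im (z u))).
Qed.

Lemma polar_summable g : rsummable (fun v =>
  normc ((weight v / modulus (parent v))%:C%C * g (parent v)) ^+ 2).
Proof.
pose p u := normc (g u) ^+ 2 / modulus u ^+ 2.
have p0 u : 0 <= p u by rewrite divr_ge0// sqr_ge0.
rewrite /rsummable /summable.
rewrite (eq_esum (b := fun v => (weight v ^+ 2 * p (parent v))%:E)); last first.
  move=> v _ /=; rewrite ger0_norm ?sqr_ge0//.
  rewrite ComplexField.Normc.normcM normc_real exprMn real_normK ?num_real//.
  by rewrite /p exprMn exprVn; congr (_%:E); ring.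
rewrite esum_siblings//.
apply: le_lt_trans (l2_summable g).
apply: le_esum => u _; rewrite lee_fin /= ger0_norm ?sqr_ge0//.
by rewrite /p mulrC divfK// expf_neq0// modulus_neq0.
Qed.

(** The isometry that maps e_u to the normalized S e_u. *)
Definition polar g : H := mkl2 (polar_summable g).

Lemma polarE g v : polar g v = (weight v / modulus (parent v))%:C%C * g (parent v).
Proof. by []. Qed.

Lemma polar_linear : linear polar.
Proof.
move=> c f g; apply: l2_ext => v.
rewrite -[RHS]/(c * polar f v + polar g v) !polarE.
rewrite -[(c *: f + g) _]/(c * f (parent v) + g (parent v)).
by rewrite mulrDr mulrCA.
Qed.

Lemma polar_isometry f g : dot (polar f) (polar g) = dot f g.
Proof.
have m0 u : (modulus u ^+ 2)%:C%C != 0 :> C.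
  by rewrite eq_complex /= eqxx andbT expf_neq0// modulus_neq0.
pose z u : C := f u * conjC (g u) / (modulus u ^+ 2)%:C%C.
transitivity (csum (fun v => (weight v ^+ 2)%:C%C * z (parent v))).
  rewrite /l2_dot; congr csum; apply/funext => v; rewrite !polarE /z.
  rewrite conj_realM mulrACA -rmorphM -expr2 exprMn exprVn rmorphM fmorphV; ring.
rewrite csum_siblings /l2_dot; congr csum; apply/funext => u.
by rewrite /z mulrC divfK.
Qed.

Lemma scale_summable g (c : vertex -> R) : (forall u, `|c u| <= 1) ->
  rsummable (fun u => normc ((c u)%:C%C * g u) ^+ 2).
Proof.
move=> c1; apply: le_rsummable (l2_summable g) => u.
rewrite !ger0_norm ?sqr_ge0// ComplexField.Normc.normcM normc_real exprMn.
by rewrite ler_piMl ?sqr_ge0// exprn_ile1.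
Qed.

(** Because w >= 1, dividing by w preserves square-summability. *)
Lemma mul_modulus_surj g : exists f, mul_op modulus (f, g).
Proof.
have c1 u : `|(modulus u)^-1| <= 1.
  by rewrite normfV gtr0_norm ?modulus_gt0// invf_le1 ?modulus_gt0// modulus_ge1.
exists (mkl2 (scale_summable g c1)) => u /=.
by rewrite -[RHS]/((modulus u)%:C%C * ((modulus u)^-1%:C%C * g u))
  mulrA -rmorphM divff ?mul1r// modulus_neq0.
Qed.

(** The sum that defines the domain of S is the squared norm of w f. *)
Lemma shift_polar : S = opcomp (everywhere polar) (mul_op modulus).
Proof.
have domE f : ((\esum_(u in [set: vertex])
       ((\esum_(v in children u) (`|weight v| ^+ 2)%:E) *
        (normc (f u) ^+ 2)%:E) < +oo)%E) =
     rsummable (fun u => normc ((modulus u)%:C%C * f u) ^+ 2) :> Prop.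
  rewrite /rsummable /summable; congr (is_true (_ < _)%E).
  apply: eq_esum => u _; rewrite esum_weight -EFinM.
  rewrite -[RHS]/(`|(normc ((modulus u)%:C%C * f u) ^+ 2)%:E|)%E.
  rewrite gee0_abs ?lee_fin ?sqr_ge0//.
  by congr (_%:E); rewrite ComplexField.Normc.normcM normc_real [RHS]exprMn real_normK ?num_real.
have key f h v : mul_op modulus (f, h) ->
    polar h v = (weight v)%:C%C * f (parent v).
  move=> /mul_opP fh; rewrite polarE fh mulrA -rmorphM divfK//.
  exact: modulus_neq0.
have SE f k : S (f, k) <->
    rsummable (fun u => normc ((modulus u)%:C%C * f u) ^+ 2) /\
    forall v, k v = (weight v)%:C%C * f (parent v).
  by rewrite -domE.
apply/seteqP; split => -[f k].
  move=> /SE[sf kv]; exists (mkl2 sf); split=> //.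
  by apply: l2_ext => v; rewrite (key f)// kv.
move=> [h [fh kh]]; apply/SE; split; last first.
  by move=> v; rewrite [k]kh; exact: key.
by move/mul_opP in fh; under eq_fun do rewrite -fh; exact: l2_summable.
Qed.

(** One inclusion tests the adjoint against the points. For the other one, w f
is square-summable as soon as w^2 f is, again because w >= 1, and the isometry
of U does the rest. *)
Lemma adjoint_shift : opcomp (adjoint dot S) S = mul_op (fun u => modulus u ^+ 2).
Proof.
rewrite shift_polar; apply/seteqP; split => -[f h].
  move=> [k [[h1 [/mul_opP fh1 kh]] adj]]; apply/mul_opP => u.
  have {kh} kE : k = polar h1 := kh.
  have wu : opcomp (everywhere polar) (mul_op modulus)
      (l2_point u, polar ((modulus u)%:C%C *: l2_point u)).
    by exists ((modulus u)%:C%C *: l2_point u); split=> //; exact: mul_op_point.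
  have := adj _ _ wu.
  rewrite /= kE polar_isometry linearZl_LR /= => e.
  have {}e : (modulus u)%:C%C * h1 u = h u.
    have := congr1 conjC e; rewrite conj_realM -!(ip_conj dot) => e'.
    apply: etrans (congr1 _ (esym (l2_dot_point h1 u))) _.
    exact: etrans e' (l2_dot_point h u).
  by rewrite -e fh1 mulrA -rmorphM.
move=> /mul_opP fh; have c1 u : `|(modulus u)^-1| <= 1.
  by rewrite normfV gtr0_norm ?modulus_gt0// invf_le1 ?modulus_gt0// modulus_ge1.
pose h1 : H := mkl2 (scale_summable h c1).
have fh1 u : h1 u = (modulus u)%:C%C * f u.
  rewrite -[LHS]/((modulus u)^-1%:C%C * h u) fh mulrA -rmorphM.
  by rewrite expr2 mulKf// modulus_neq0.
exists (polar h1); split; first by exists h1.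
move=> f' g' [h' [/mul_opP fh' gh]]; rewrite /= (_ : g' = polar h')// polar_isometry /l2_dot.
congr csum; apply/funext => u; rewrite fh' fh1 fh.
by rewrite !conj_realM rmorphXn; ring.
Qed.

Lemma oppow_modulus (r : R) :
  oppow dot (mul_op modulus) r = mul_op (fun u => modulus u `^ r).
Proof.
apply: (@oppow_mul_op _ _ _ entry_sum (fun n => Num.sqrt zeta2 * 2 ^+ n)) => // u.
exact/ltW/modulus_gt0.
Qed.

Lemma opabs_shift : opabs dot S = mul_op modulus.
Proof.
rewrite /opabs adjoint_shift.
rewrite (@oppow_mul_op _ _ _ entry_sum (fun n => zeta2 * (2 ^+ n) ^+ 2)).
- congr mul_op; apply/funext => u; rewrite powR12_sqrt ?sqr_ge0// sqrtr_sqr.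
  by rewrite gtr0_norm// modulus_gt0.
- exact: modulus_sqr.
- by move=> u; exact: sqr_ge0.
Qed.

Lemma polar0 : polar 0 = 0.
Proof. by apply: l2_ext => v; exact: mulr0. Qed.

Lemma polar_eq0 g : polar g = 0 -> g = 0.
Proof.
move=> e; have := polar_isometry g g; rewrite e linear0l => /esym/eqP.
by rewrite (dnorm_eq0 dot) => /eqP.
Qed.

Lemma polar_is_factor : is_polar_factor dot S polar.
Proof.
split.
- split.
  + exact: polar_linear.
  + exists 1 => f; rewrite mul1r le_eqVlt; apply/orP; left.
    exact/eqP/polar_isometry.
  + by move=> f _; exact: polar_isometry.
- move=> f; rewrite shift_polar; split=> [/polar_eq0 ->|[h [/mul_opP fh /esym/polar_eq0 h0]]].
    exists 0; split; last exact/esym/polar0.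
    by apply/mul_opP => u; exact/esym/mulr0.
  suff -> : f = 0 by exact: polar0.
  have {}h0 : h = 0 := h0.
  apply: l2_ext => u; have := fh u; rewrite h0 => /esym/eqP.
  rewrite mulf_eq0 => /orP[|/eqP//].
  by rewrite eq_complex /= eqxx andbT (negbTE (modulus_neq0 u)).
- by rewrite opabs_shift shift_polar.
Qed.

(** Since |S| is onto, U is determined by S = U |S| alone. *)
Lemma polar_factor_shift : polar_factor dot S = polar.
Proof.
have [_ _] : is_polar_factor dot S (polar_factor dot S).
  by apply: xgetPex; exists polar; exact: polar_is_factor.
rewrite opabs_shift [X in X = _]shift_polar => e; apply/funext => g.
have [f fg] := mul_modulus_surj g.
have : opcomp (everywhere polar) (mul_op modulus) (f, polar g) by exists g.
rewrite e => -[h [/mul_opP fh ph]].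
have hg : h = g by apply: l2_ext => u; rewrite fh; exact/esym/fg.
by rewrite -[in LHS]hg; exact/esym/ph.
Qed.

Lemma aluthge_shift (t : R) : aluthge dot t S =
  opcomp (mul_op (fun u => modulus u `^ t))
    (opcomp (everywhere polar) (mul_op (fun u => modulus u `^ (1 - t)))).
Proof. by rewrite /aluthge opabs_shift !oppow_modulus polar_factor_shift. Qed.

End shift.

(** * Growth along siblings *)

Lemma l2_coord_le (R : realType) (I : choiceType) (f : l2 I : lmodType R[i]) i :
  ComplexField.Normc.normc (f i) ^+ 2 <= sqnorm (@l2_dot R I) f.
Proof.
rewrite sqnorm_l2 rsum_ge0; last 2 first.
- by move=> j; exact: sqr_ge0.
- exact: l2_summable.
rewrite -lee_fin fineK; last first.
  by apply: esum_ge0_finE (l2_summable f) => j; exact: sqr_ge0.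
rewrite (esumID [set i])//; last by move=> j _; rewrite lee_fin sqr_ge0.
rewrite setTI esum_set1 ?lee_fin ?sqr_ge0// leeDl// esum_ge0// => j _.
by rewrite lee_fin sqr_ge0.
Qed.

(** Take 0 < d <= 1 with (1 + d)^2 <= r; by the Bernoulli inequality
r^n >= (1 + n d)^2 >= d^2 (n + 1)^2. *)
Lemma geometric_over_linear (R : realType) (r : R) : 1 < r ->
  exists2 c, 0 < c & forall n, c * n.+1%:R <= r ^+ n / n.+1%:R.
Proof.
move=> r1; pose d := Num.min 1 (Num.sqrt r - 1).
have sr1 : 1 < Num.sqrt r by rewrite -[1]sqrtr1 ltr_sqrt// (lt_trans ltr01).
have d0 : 0 < d by rewrite lt_min ltr01 subr_gt0.
have d1 : d <= 1 by rewrite ge_min lexx.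
have dr : 1 + d <= Num.sqrt r by rewrite -lerBrDl ge_min lexx orbT.
have bern n : 1 + n%:R * d <= (1 + d) ^+ n.
  elim: n => [|n IH]; first by rewrite mul0r addr0 expr0.
  rewrite exprS; apply: le_trans (ler_wpM2l _ IH); last by rewrite addr_ge0// ltW.
  rewrite -natr1; have : 0 <= n%:R :> R by rewrite ler0n.
  have := sqr_ge0 d; nra.
exists (d ^+ 2) => [|n]; first exact: exprn_gt0.
rewrite ler_pdivlMr ?ltr0n// -mulrA -expr2 -exprMn.
apply: (@le_trans _ _ ((1 + n%:R * d) ^+ 2)).
  rewrite ler_sqr ?nnegrE ?mulr_ge0 ?addr_ge0 ?mulr_ge0 ?ler0n// ?(ltW d0)//.
  by rewrite -natr1 mulrDr mulr1 mulrC addrC lerD2r.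
apply: (@le_trans _ _ (((1 + d) ^+ n) ^+ 2)).
  by rewrite ler_sqr ?nnegrE ?exprn_ge0 ?addr_ge0 ?mulr_ge0 ?(ltW d0)// ltW.
rewrite -exprM mulnC exprM lerXn2r ?nnegrE ?sqr_ge0 ?(le_trans ler01 (ltW r1))//.
rewrite -[leRHS]sqr_sqrtr ?(le_trans ler01 (ltW r1))//.
by rewrite ler_sqr ?nnegrE ?sqrtr_ge0// addr_ge0// ltW.
Qed.

Lemma le_1Dsqr (R : realType) (x y : R) : 0 <= x -> x ^+ 2 <= y -> x <= 1 + y.
Proof. by have := sqr_ge0 (x - 1); nra. Qed.

(** The value of h at the n-th child of u is g(u) times a positive constant
times 2^(t n) / (n + 1), whereas the coordinates of h are bounded by its
norm. *)
Lemma polar_powR_null (R : realType) (t : R) (g h : l2 vertex : lmodType R[i]) :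
  0 < t -> mul_op (fun u => modulus R u `^ t) (polar g, h) -> g = 0.
Proof.
move=> t0 /mul_opP gh; apply: l2_ext => u; apply: contrapT => gu0.
have m0 := modulus_gt0 R u; set m := modulus R u in m0.
pose G := ComplexField.Normc.normc (g u).
have G0 : 0 < G.
  rewrite lt_def; apply/andP; split; last first.
    by rewrite /G; case: (g u) => x y; exact: sqrtr_ge0.
  by apply/eqP => /ComplexField.Normc.eq0_normc.
have [c c0 cr] : exists2 c, 0 < c &
    forall n, c * n.+1%:R <= (2 `^ t) ^+ n / n.+1%:R :> R.
  apply: geometric_over_linear; have := @gt0_ltr_powR R t t0 1 2.
  by rewrite powR1; apply; rewrite ?nnegrE// ltr1n.
pose K : R := m `^ t * 2 ^+ entry_sum u / m * G.
have K0 : 0 < K by rewrite mulr_gt0// divr_gt0// mulr_gt0 ?powR_gt0// exprn_gt0.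
have pow2 n : (2 ^+ n) `^ t = (2 `^ t) ^+ n :> R.
  by rewrite -powR_mulrn// -powRrM mulrC powRrM powR_mulrn// powR_ge0.
have hn n : ComplexField.Normc.normc (h (child u n)) = K * ((2 `^ t) ^+ n / n.+1%:R).
  rewrite gh polarE parent_child !ComplexField.Normc.normcM !normc_real.
  rewrite !ger0_norm ?powR_ge0//; last first.
    by rewrite divr_ge0 ?(ltW m0) ?(ltW (weight_child_gt0 _ _ _)).
  rewrite weight_child modulus_child -/m -/G.
  rewrite powRM ?exprn_ge0 ?(ltW m0)// pow2 /K.
  have regroup (a b d e x y : R) : a * d * (b * e * x * y) = a * b * x * y * (d * e).
    by ring.
  exact: regroup.
pose B := 1 + sqnorm (@l2_dot R vertex) h.
have bound n : K * c * n.+1%:R <= B.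
  have kc0 : 0 <= K * c * n.+1%:R by rewrite mulr_ge0// mulr_ge0 ?ltW.
  have hle : K * c * n.+1%:R <= ComplexField.Normc.normc (h (child u n)).
    by rewrite hn -mulrA ler_pM2l.
  apply: (le_trans hle).
  exact: le_1Dsqr (le_trans kc0 hle) (l2_coord_le h (child u n)).
have Kc0 : 0 < K * c by exact: mulr_gt0.
have := truncnS_gt (B / (K * c)).
by rewrite ltr_pdivrMr// mulrC ltNge bound.
Qed.

Theorem proposition6p3 (R : realType) (t : R) (t_gt0 : 0 < t) (t_le1 : t <= 1) :
  dom (aluthge (@l2_dot R vertex) t (weighted_shift (@weight R))) = [set 0].
Proof.
rewrite aluthge_shift; apply/seteqP; split => [f|f ->].
  move=> [h [k [[g [/mul_opP fg kg]] kh]]].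
  have {}kg : k = polar g := kg.
  have g0 : g = 0 by apply: (polar_powR_null (h := h) t_gt0); rewrite -kg.
  apply: l2_ext => u; have := fg u; rewrite g0 => /esym/eqP.
  rewrite mulf_eq0 => /orP[|/eqP//].
  by rewrite eq_complex /= eqxx andbT gt_eqF// powR_gt0// modulus_gt0.
exists 0, 0; split; last by apply/mul_opP => u; exact/esym/mulr0.
exists 0; split; last exact/esym/polar0.
by apply/mul_opP => u; exact/esym/mulr0.
Qed.
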